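(* Let $k$ be a field of characteristic zero and let $f$ be an element of the ring $k[[x_1,\ldots,x_n]]$ that is not a unit. Then the local ring \[ \frac{k[[x_1,\ldots,x_n]]}{\sqrt{(f)}} \] is regular if and only if all elements of the set \[ \operatorname{Ass}_{k[[x_1,\ldots,x_n]]}\left(\frac{k[[x_1,\ldots,x_n]]}{(f,I_{\nabla f})}\right) \] have height one.
   Context: Here $k[[x_1,\ldots,x_n]]$ is the ring of formal power series over $k$. For $f\in k[[x_1,\ldots,x_n]]$, the gradient ideal of $f$ is $I_{\nabla f}:=\left(\frac{\partial f}{\partial x_1},\ldots,\frac{\partial f}{\partial x_n}\right)\subseteq k[[x_1,\ldots,x_n]]$, and the Jacobian ideal of $f$ is $(f,I_{\nabla f})$, the ideal generated by $f$ and all its first partial derivatives. For an $R$-module $M$, a prime ideal $\mathfrak{p}\subseteq R$ is an associated prime of $M$ if $\mathfrak{p}=\operatorname{Ann}(Rm)$ for some $m\in M$; $\operatorname{Ass}_R(M)$ is the set of all associated primes of $M$.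
   Formalization: The element f is additionally assumed nonzero: for f = 0 the quotient is k[[x_1,...,x_n]], which is regular, while the only associated prime is (0), of height zero, so the equivalence fails there. *)

(* Defs.v *)
From HB Require Import structures.
From mathcomp Require Import all_boot all_algebra.
From mathcomp Require Import mpoly.
From mathcomp Require Import boolp classical_sets.

Set Implicit Arguments.
Unset Strict Implicit.
Unset Printing Implicit Defensive.

Import GRing.Theory.

Local Open Scope ring_scope.
Local Open Scope quotient_scope.
Local Open Scope classical_set_scope.

Identity Coercion set_to_fun : set >-> Funclass.

(* Ideals are Prop-valued and possibly improper, unlike the decidable proper
   ideals [idealr] of ring_quotient.v; rings may be zero. *)

Record ideal (R : comPzRingType) := Ideal {
  ideal_set :> set R;
  ideal_zero : ideal_set 0;
  ideal_add : forall x y, ideal_set x -> ideal_set y -> ideal_set (x + y);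
  ideal_mul : forall a x, ideal_set x -> ideal_set (a * x)
}.

Section Ideals.
Variable R : comPzRingType.
Implicit Types (S : set R) (I p m : ideal R).

Definition generated_set S : set R :=
  [set x | forall I, S `<=` I -> I x].

Fact generated_zero S : generated_set S 0.
Proof. by move=> I _; apply: ideal_zero. Qed.

Fact generated_add S x y :
  generated_set S x -> generated_set S y -> generated_set S (x + y).
Proof. by move=> Sx Sy I SI; apply: ideal_add; [apply: Sx | apply: Sy]. Qed.

Fact generated_mul S a x : generated_set S x -> generated_set S (a * x).
Proof. by move=> Sx I SI; apply: ideal_mul; apply: Sx. Qed.

Definition generated S : ideal R :=
  Ideal (@generated_zero S) (@generated_add S) (@generated_mul S).

(* n = 0 is harmless: it forces I, hence its radical, to be the whole ring. *)
Definition radical_set I : set R := [set x | exists n, I (x ^+ n)].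

Fact radical_zero I : radical_set I 0.
Proof. by exists 1%N; rewrite expr1; apply: ideal_zero. Qed.

Fact radical_add I x y :
  radical_set I x -> radical_set I y -> radical_set I (x + y).
Proof.
case=> a Ia [b Ib]; exists (a + b)%N; rewrite exprDn.
elim/big_ind: _ => [|u v|i _]; [exact: ideal_zero | exact: ideal_add |].
rewrite -mulr_natl; apply: ideal_mul; case: (leqP b i) => [le_bi | lt_ib].
  by rewrite -(subnK le_bi) exprD mulrA; apply: ideal_mul.
rewrite mulrC; apply: ideal_mul.
have -> : (a + b - i = (b - i) + a)%N by rewrite addnBAC 1?[in RHS]addnC // ltnW.
by rewrite exprD; apply: ideal_mul.
Qed.

Fact radical_mul I a x : radical_set I x -> radical_set I (a * x).
Proof. by case=> n In; exists n; rewrite exprMn; apply: ideal_mul. Qed.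

Definition radical I : ideal R :=
  Ideal (@radical_zero I) (@radical_add I) (@radical_mul I).

Definition prime_ideal p : Prop :=
  ~ p 1 /\ forall x y, p (x * y) -> p x \/ p y.

Definition maximal_ideal m : Prop :=
  ~ m 1 /\ forall I, m `<=` I -> ~ I 1 -> I = m :> set R.

(* A strictly increasing chain c 0 < ... < c l of primes, of length l; the
   values of c beyond l are irrelevant. *)
Definition prime_chain (c : nat -> ideal R) (l : nat) : Prop :=
  (forall i, (i <= l)%N -> prime_ideal (c i)) /\
  (forall i, (i < l)%N -> c i `<` c i.+1).

(* Height and Krull dimension may be infinite, hence relations. *)
Definition has_height p (h : nat) : Prop :=
  (exists c, prime_chain c h /\ c h = p :> set R) /\
  (forall c l, prime_chain c l -> c l = p :> set R -> (l <= h)%N).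

End Ideals.

Definition krull_dim (R : comPzRingType) (d : nat) : Prop :=
  (exists c : nat -> ideal R, prime_chain c d) /\
  (forall (c : nat -> ideal R) l, prime_chain c l -> (l <= d)%N).

Definition generated_by (R : comPzRingType) (I : ideal R) (r : nat) : Prop :=
  exists a : 'I_r -> R, I = generated (range a) :> set R.

Definition noetherian (R : comPzRingType) : Prop :=
  forall I : ideal R, exists r, generated_by I r.

Definition regular_local_ring (R : comPzRingType) : Prop :=
  noetherian R /\
  exists m : ideal R,
    [/\ maximal_ideal m,
        forall m' : ideal R, maximal_ideal m' -> m' = m :> set R
      & exists d, krull_dim R d /\ generated_by m d].

Definition in_ideal (R : comPzRingType) (I : ideal R) : R -> bool :=
  fun x => `[< I x >].

Fact in_ideal_zmod (R : comPzRingType) (I : ideal R) :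
  zmod_closed (in_ideal I).
Proof.
split=> [|x y /asboolP Ix /asboolP Iy]; apply/asboolP; first exact: ideal_zero.
by apply: ideal_add => //; rewrite -mulN1r; apply: ideal_mul.
Qed.

HB.instance Definition _ (R : comPzRingType) (I : ideal R) :=
  GRing.isZmodClosed.Build R (in_ideal I) (in_ideal_zmod I).

(* R / I, both as a ring and as an R-module. ring_quotient.v provides the
   additive quotient, but its ring structure only for proper ideals. *)
Definition quo (R : comPzRingType) (I : ideal R) : Type :=
  Quotient.quot (GRing.ZmodClosed.clone R (in_ideal I) _).

HB.instance Definition _ (R : comPzRingType) (I : ideal R) :=
  ZmodQuotient.on (quo I).

Section QuotientRing.
Variables (R : comPzRingType) (I : ideal R).
Implicit Types x y z : quo I.

Fact quo_eqP (a b : R) :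
  (\pi_(quo I) a = \pi_(quo I) b) <-> I (a - b).
Proof.
split=> [/eqP|Iab]; first by rewrite -Quotient.idealrBE => /asboolP.
by apply/eqP; rewrite -Quotient.idealrBE; apply/asboolP.
Qed.

Fact quo_surj x : exists a, x = \pi_(quo I) a.
Proof. by exists (repr x); rewrite reprK. Qed.

Definition quo_one : quo I := \pi_(quo I) 1.
Definition quo_mul x y : quo I := \pi_(quo I) (repr x * repr y).

Fact quo_pi_mul (a b : R) :
  \pi_(quo I) (a * b) = quo_mul (\pi_(quo I) a) (\pi_(quo I) b).
Proof.
rewrite /quo_mul; set a' := repr _; set b' := repr _.
have Ia : I (a - a') by apply/quo_eqP; rewrite reprK.
have Ib : I (b - b') by apply/quo_eqP; rewrite reprK.
apply/quo_eqP.
have -> : a * b - a' * b' = a * (b - b') + b' * (a - a').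
  by rewrite !mulrBr addrA (mulrC a b') (mulrC a' b') subrK.
by apply: ideal_add; apply: ideal_mul.
Qed.

Fact quo_mulA : associative quo_mul.
Proof.
move=> x y z; have [a ->] := quo_surj x; have [b ->] := quo_surj y.
have [c ->] := quo_surj z.
by rewrite -!quo_pi_mul mulrA.
Qed.

Fact quo_mulC : commutative quo_mul.
Proof. by move=> x y; rewrite /quo_mul mulrC. Qed.

Fact quo_mul1 : left_id quo_one quo_mul.
Proof. by move=> x; have [a ->] := quo_surj x; rewrite -quo_pi_mul mul1r. Qed.

Fact quo_mulDl : left_distributive quo_mul +%R.
Proof.
move=> x y z; have [a ->] := quo_surj x; have [b ->] := quo_surj y.
have [c ->] := quo_surj z.
by rewrite -!quo_pi_mul -raddfD -quo_pi_mul mulrDl raddfD.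
Qed.

HB.instance Definition _ :=
  GRing.Zmodule_isComPzRing.Build (quo I) quo_mulA quo_mulC quo_mul1 quo_mulDl.

Definition quo_scale (a : R) x : quo I := \pi_(quo I) a * x.

Fact quo_scaleA a b x : quo_scale a (quo_scale b x) = quo_scale (a * b) x.
Proof. by rewrite /quo_scale mulrA; congr (_ * _); rewrite quo_pi_mul. Qed.

Fact quo_scale1 : left_id 1 quo_scale.
Proof. by move=> x; rewrite /quo_scale mul1r. Qed.

Fact quo_scaleDr : right_distributive quo_scale +%R.
Proof. by move=> a x y; apply: mulrDr. Qed.

Fact quo_scaleDl x : {morph quo_scale^~ x : a b / a + b}.
Proof. by move=> a b; rewrite /quo_scale raddfD mulrDl. Qed.

HB.instance Definition _ :=
  GRing.Zmodule_isLmodule.Build R (quo I)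
    quo_scaleA quo_scale1 quo_scaleDr quo_scaleDl.

End QuotientRing.

Section AssociatedPrimes.
Variables (R : comPzRingType) (M : lmodType R).

Definition annihilator (N : set M) : set R :=
  [set a | forall x, N x -> a *: x = 0].

Definition cyclic_submodule (x : M) : set M := range (fun a : R => a *: x).

Definition Ass : set (ideal R) :=
  [set p | prime_ideal p /\
    exists x : M, p = annihilator (cyclic_submodule x) :> set R].

End AssociatedPrimes.
Arguments Ass {R} M.

(* k[[x_1,...,x_n]]: coefficient families indexed by multi-indices, with the
   Cauchy product. *)
Record fps (n : nat) (k : Type) := Fps { fps_coef :> 'X_{1..n} -> k }.

Lemma fpsP n k (f g : fps n k) : f =1 g -> f = g.
Proof. by case: f => f; case: g => g /= /funext ->. Qed.

HB.instance Definition _ n k := gen_eqMixin (fps n k).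
HB.instance Definition _ n k := gen_choiceMixin (fps n k).

Section FpsRing.
Variables (n : nat) (k : comNzRingType).
Implicit Types (f g h : fps n k) (m : 'X_{1..n}).

Definition fps_zero : fps n k := Fps (fun=> 0).
Definition fps_opp f : fps n k := Fps (fun m => - f m).
Definition fps_add f g : fps n k := Fps (fun m => f m + g m).

Fact fps_addA : associative fps_add.
Proof. by move=> f g h; apply: fpsP => m; apply: addrA. Qed.
Fact fps_addC : commutative fps_add.
Proof. by move=> f g; apply: fpsP => m; apply: addrC. Qed.
Fact fps_add0 : left_id fps_zero fps_add.
Proof. by move=> f; apply: fpsP => m; apply: add0r. Qed.
Fact fps_addN : left_inverse fps_zero fps_opp fps_add.
Proof. by move=> f; apply: fpsP => m; apply: addNr. Qed.

HB.instance Definition _ :=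
  GRing.isZmodule.Build (fps n k) fps_addA fps_addC fps_add0 fps_addN.

Definition fps_one : fps n k := Fps (fun m => (m == 0%MM)%:R).

(* The degree bound only makes the range of pairs finite: the condition
   already forces both multi-indices to have degree at most [mdeg m]. *)
Definition fps_mul f g : fps n k := Fps (fun m =>
  \sum_(ij : 'X_{1..n < (mdeg m).+1, (mdeg m).+1} | m == (ij.1 + ij.2)%MM)
    f ij.1 * g ij.2).

(* The ring axioms are transferred from {mpoly k[n]} by truncation. *)
Let agree d f (p : {mpoly k[n]}) :=
  forall m, (mdeg m < d)%N -> f m = p@_m.

Let trunc d f : {mpoly k[n]} :=
  \sum_(m : 'X_{1..n < d}) f m *: 'X_[m].

Let agree_trunc d f : agree d f (trunc d f).
Proof. by move=> m lt_md; rewrite mcoeff_mpoly. Qed.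

Let agree_mul d f g p q : agree d f p -> agree d g q ->
  agree d (fps_mul f g) (p * q).
Proof.
move=> fp gq m lt_md; rewrite mcoeffM /=; apply: eq_bigr => ij _.
have leq_d (i : 'X_{1..n < (mdeg m).+1}) : (mdeg i < d)%N.
  by apply: leq_trans lt_md; apply: bmdeg.
by rewrite fp ?gq ?leq_d.
Qed.

Let agree_one d : agree d fps_one 1.
Proof. by move=> m _; rewrite mcoeff1. Qed.

Let agree_add d f g p q : agree d f p -> agree d g q ->
  agree d (fps_add f g) (p + q).
Proof. by move=> fp gq m lt_md; rewrite mcoeffD /= fp ?gq. Qed.

Fact fps_mulA : associative fps_mul.
Proof.
move=> f g h; apply: fpsP => m; set d := (mdeg m).+1.
have [[Af Ag] Ah] := (@agree_trunc d f, @agree_trunc d g, @agree_trunc d h).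
rewrite (agree_mul Af (agree_mul Ag Ah)) // mulrA.
by rewrite (agree_mul (agree_mul Af Ag) Ah).
Qed.

Fact fps_mulC : commutative fps_mul.
Proof.
move=> f g; apply: fpsP => m; set d := (mdeg m).+1.
have [Af Ag] := (@agree_trunc d f, @agree_trunc d g).
by rewrite (agree_mul Af Ag) // mulrC (agree_mul Ag Af).
Qed.

Fact fps_mul1 : left_id fps_one fps_mul.
Proof.
move=> f; apply: fpsP => m; have Af := @agree_trunc (mdeg m).+1 f.
by rewrite (agree_mul (@agree_one _) Af) // mul1r Af.
Qed.

Fact fps_mulDl : left_distributive fps_mul fps_add.
Proof.
move=> f g h; apply: fpsP => m; set d := (mdeg m).+1.
have [[Af Ag] Ah] := (@agree_trunc d f, @agree_trunc d g, @agree_trunc d h).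
rewrite (agree_mul (agree_add Af Ag) Ah) // mulrDl.
by rewrite (agree_add (agree_mul Af Ah) (agree_mul Ag Ah)).
Qed.

Fact fps_one_neq0 : fps_one != 0.
Proof.
apply/eqP => /(congr1 (fun f : fps n k => f 0%MM)) /=.
by rewrite eqxx; apply/eqP/oner_neq0.
Qed.

HB.instance Definition _ := GRing.Zmodule_isComNzRing.Build (fps n k)
  fps_mulA fps_mulC fps_mul1 fps_mulDl fps_one_neq0.

Definition fps_unit : {pred fps n k} := fun f => `[< exists g, g * f = 1 >].

Definition fps_inv f : fps n k :=
  if pselect (exists g, g * f = 1) is left ex then projT1 (cid ex) else f.

Fact fps_mulVf : {in fps_unit, left_inverse 1 fps_inv *%R}.
Proof.
move=> f /asboolP ex; rewrite /fps_inv; case: pselect => // ex'.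
exact: projT2 (cid ex').
Qed.

Fact fps_unitP f g : g * f = 1 -> fps_unit f.
Proof. by move=> gf; apply/asboolP; exists g. Qed.

Fact fps_inv_out : {in [predC fps_unit], fps_inv =1 id}.
Proof.
move=> f; rewrite inE => /asboolPn nex; rewrite /fps_inv.
by case: pselect.
Qed.

HB.instance Definition _ := GRing.ComNzRing_hasMulInverse.Build (fps n k)
  fps_mulVf fps_unitP fps_inv_out.

Definition fps_deriv (i : 'I_n) f : fps n k :=
  Fps (fun m => f (m + U_(i))%MM *+ (m i).+1).

Definition gradient_ideal f : ideal (fps n k) :=
  generated (range (fun i => fps_deriv i f)).

Definition jacobian_ideal f : ideal (fps n k) :=
  generated ([set f] `|` gradient_ideal f).

End FpsRing.

(* Main.v *)
Require Import Defs.
From HB Require Import structures.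
From mathcomp Require Import all_boot all_order all_algebra.
From mathcomp Require Import mpoly.
From mathcomp Require Import boolp classical_sets.
From mathcomp Require Import zify ring.

(** Let R be the ring of power series.

    If R/rad(f) is regular, its dimension d is less than n because a chain of
    primes containing f can be extended by the zero ideal, and R has dimension
    at most n [fps_dim_le]. Its maximal ideal has d generators, so rad(f) must
    contain an element g with a nonzero linear part [regular_quo_order1]. Such a
    g is prime, hence f = u g^(b+1) with u a unit [regular_quo_power]. In
    characteristic zero some partial derivative of f is g^b times a unit, so the
    Jacobian ideal is (g^b), and (g) is the only possible associated prime; it
    has height one [Ass_jacobian_power].

    For the converse, let J be the Jacobian ideal, and d the order of f. After a
    linear change of coordinates, f is regular of order d in the last variable x
    [coordinate_change], and its derivative H along x, which lies in J, is
    regular of order d - 1. Let A be the ring of power series in the other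
    variables. By Weierstrass division R/(H) is free over A with basis
    1, ..., x^(d-2). If all associated primes of R/J have height one, none of
    them meets A, so R/J is torsion-free over A [torsionfree_of_height1]. All
    elements of J have order at least d - 1. This forces J = (H)
    [torsionfree_principal]: otherwise 1, ..., x^(d-2) are dependent modulo J,
    and multiplication by x on R/J, over the fraction field of A, has a
    characteristic polynomial of some degree e < d - 1. Its value at x is a
    power series because R is completely integrally closed
    [fps_completely_integrally_closed], and this series lies in J because R/J is
    torsion-free; but it contains the monomial x^e, of too small a degree. This
    argument replaces unique factorization.

    So f = g H. Here g has order one, and comparing f = g H with its derivative
    shows that f = w g^d with w a unit [divisible_by_deriv]. Then rad(f) = (g),
    and R/(g) is isomorphic to A, which is regular [quo_rad_regular].

    The order on monomials is used throughout: division of a power series by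
    finitely many others with respect to leading monomials [fps_division]
    specializes to Weierstrass division and yields noetherianity and complete
    integral closedness as well. *)

Set Implicit Arguments.
Unset Strict Implicit.
Unset Printing Implicit Defensive.

Import Order.TTheory GRing.Theory.
Local Open Scope ring_scope.
Local Open Scope classical_set_scope.

(** * Coefficients *)

(** The summation indices of a product carry the degree of the target monomial
    m in their type, so that m cannot be rewritten in their presence; equations
    between monomials are transported by these lemmas instead. *)
Lemma mnm_eq_at n (m m' : 'X_{1..n}) j : m = m' -> m j = m' j.
Proof. by move=> ->. Qed.

Lemma mnmD_eql n (a b m : 'X_{1..n}) : (a + b = m)%MM -> a = (m - b)%MM.
Proof. by move=> <-; rewrite addmK. Qed.

Lemma mnmD_eqr n (m1 m2 u v : 'X_{1..n}) :
  (m1 + m2 = u + v)%MM -> u = m1 -> v = m2.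
Proof. by move=> e eu; move: e; rewrite eu => /addmI. Qed.

Section Coefficients.
Variables (n : nat) (k : comNzRingType).
Implicit Types (f g : fps n k) (m : 'X_{1..n}) (d : nat).

Lemma fps0E m : (0 : fps n k) m = 0. Proof. by []. Qed.
Lemma fps1E m : (1 : fps n k) m = (m == 0%MM)%:R. Proof. by []. Qed.
Lemma fpsDE f g m : (f + g) m = f m + g m. Proof. by []. Qed.
Lemma fpsBE f g m : (f - g) m = f m - g m. Proof. by []. Qed.
Lemma fpsME f g m : (f * g) m =
  \sum_(ij : 'X_{1..n < (mdeg m).+1, (mdeg m).+1} | m == (ij.1 + ij.2)%MM)
    f ij.1 * g ij.2.
Proof. by []. Qed.

Lemma fps_sumE (I : Type) (r : seq I) (P : pred I) (F : I -> fps n k) m :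
  (\sum_(i <- r | P i) F i) m = \sum_(i <- r | P i) F i m.
Proof. by elim/big_rec2: _ => // i x y _ <-. Qed.

Lemma fpsMnE f j m : (f *+ j) m = f m *+ j.
Proof. by elim: j => // j IH; rewrite !mulrS fpsDE IH. Qed.

(** Identities between power series are checked on polynomials that agree
    with them up to a high enough degree. *)
Definition agree d f (p : {mpoly k[n]}) : Prop :=
  forall m, (mdeg m < d)%N -> f m = p@_m.

Definition truncate d f : {mpoly k[n]} := \sum_(m : 'X_{1..n < d}) f m *: 'X_[m].

Lemma agree_truncate d f : agree d f (truncate d f).
Proof. by move=> m lt_md; rewrite mcoeff_mpoly. Qed.

Lemma agreeD d f g p q : agree d f p -> agree d g q -> agree d (f + g) (p + q).
Proof. by move=> fp gq m lt_md; rewrite fpsDE fp ?gq ?mcoeffD. Qed.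

Lemma agreeB d f g p q : agree d f p -> agree d g q -> agree d (f - g) (p - q).
Proof. by move=> fp gq m lt_md; rewrite fpsBE fp ?gq ?mcoeffB. Qed.

Lemma agreeM d f g p q : agree d f p -> agree d g q -> agree d (f * g) (p * q).
Proof.
move=> fp gq m lt_md; rewrite mcoeffM fpsME; apply: eq_bigr => ij _.
have leq_d (i : 'X_{1..n < (mdeg m).+1}) : (mdeg i < d)%N.
  by apply: leq_trans lt_md; apply: bmdeg.
by rewrite fp ?gq ?leq_d.
Qed.

Lemma agree_sub d e f p : (d <= e)%N -> agree e f p -> agree d f p.
Proof. by move=> le_de fp m lt_md; apply: fp; apply: leq_trans le_de. Qed.

Definition fpsX m : fps n k := Fps (fun m' => (m' == m)%:R).

Lemma agreeX d m : agree d (fpsX m) 'X_[m].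
Proof. by move=> m' _; rewrite mcoeffX eq_sym. Qed.

Lemma fpsXM f m m' :
  (fpsX m * f) m' = if (m <= m')%MM then f (m' - m)%MM else 0.
Proof.
have Af := @agree_truncate (mdeg m').+1 f.
rewrite (agreeM (@agreeX _ m) Af) //; case: ifP => [le_mm'|nle].
  rewrite -[X in _@_X](submK le_mm') addmC mulrC mcoeffMX Af // ltnS.
  exact: mdegB.
rewrite mulrC (mpolyE (truncate _ _)) mulr_suml raddf_sum big1 // => i _ /=.
rewrite -scalerAl -mpolyXD mcoeffZ mcoeffX; case: eqP => [e|_]; last exact: mulr0.
by move: nle; rewrite -e lem_addl.
Qed.

Lemma fpsX0 : fpsX 0%MM = 1. Proof. exact: fpsP. Qed.

Lemma fpsXD m m' : fpsX (m + m')%MM = fpsX m * fpsX m'.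
Proof.
apply: fpsP => l; rewrite fpsXM /=; case: ifP => [le|nle].
  by rewrite -[in LHS](submK le) (addmC _ m) eqm_add2l.
by case: eqP => // e; move: nle; rewrite e lem_addr.
Qed.

Lemma fpsXn m j : fpsX m ^+ j = fpsX (m *+ j)%MM.
Proof.
elim: j => [|j IH]; first by rewrite mulm0n fpsX0.
by rewrite exprS IH mulmS fpsXD.
Qed.

End Coefficients.

(** * Leading monomials and division *)

Section Leading.
Variables (n : nat) (k : fieldType).
Implicit Types (f g : fps n k) (m : 'X_{1..n}) (d : nat).

(** The order on monomials is graded, with finitely many monomials in each
    degree; for power series the leading monomial is the least one, contrary to
    the convention for polynomials. *)
Definition lead_at m f : Prop :=
  f m != 0 /\ forall m', (m' < m)%O -> f m' = 0.

Lemma lead_atX m : lead_at m (fpsX k m).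
Proof.
split=> [|m' lt_m'] /=; first by rewrite eqxx oner_neq0.
by rewrite lt_eqF.
Qed.

Lemma lead_at_neq0 m f : lead_at m f -> f != 0.
Proof. by case=> nz _; apply: contraNneq nz => ->. Qed.

Lemma lead_at_exists f : f != 0 -> exists m, lead_at m f.
Proof.
move=> nz; have [m fm] : exists m, f m != 0.
  apply: contrapT => no; move/eqP: nz; apply; apply: fpsP => m.
  by apply: contrapT => /eqP fm; apply: no; exists m.
elim/(@ltmwf n): m fm => m IH fm.
have [[m' [lt_m' fm']]|no] := pselect (exists m', (m' < m)%O /\ f m' != 0).
  exact: IH fm'.
exists m; split=> // m' lt_m'; apply: contrapT => /eqP fm'; apply: no.
by exists m'.
Qed.

Lemma lead_at_mdeg m f m' : lead_at m f -> (mdeg m' < mdeg m)%N -> f m' = 0.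
Proof. by case=> _ lo lt; apply: lo; apply: lt_mdeg_ltmc. Qed.

Lemma lead_at_coefM m1 m2 f g : lead_at m1 f -> lead_at m2 g ->
  (f * g) (m1 + m2)%MM = f m1 * g m2.
Proof.
move=> [_ lo1] [_ lo2]; rewrite fpsME.
have b1 : (mdeg m1 < (mdeg (m1 + m2)).+1)%N by rewrite ltnS mdegD leq_addr.
have b2 : (mdeg m2 < (mdeg (m1 + m2)).+1)%N by rewrite ltnS mdegD leq_addl.
rewrite (bigD1 (BMultinom b1, BMultinom b2)) //= big1 ?addr0 // => -[i j] /=.
case/andP=> /eqP e ne.
have [lt_i|lt_i|eq_i] := ltgtP (val i) m1; first by rewrite lo1 ?mul0r.
  rewrite lo2 ?mulr0 // ltNge; apply/negP => le_j.
  by have := ltmc_le_add lt_i le_j; rewrite -e ltxx.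
case/negP: ne; apply/eqP; congr pair; apply: val_inj => //=.
exact: mnmD_eqr e eq_i.
Qed.

Lemma lead_atM m1 m2 f g : lead_at m1 f -> lead_at m2 g ->
  lead_at (m1 + m2)%MM (f * g).
Proof.
move=> l1 l2; split; first by rewrite (lead_at_coefM l1 l2) mulf_neq0 ?l1.1 ?l2.1.
move=> m lt_m; rewrite fpsME big1 // => -[i j] /= /eqP e.
case: (ltP (val i) m1) => [lt_i|le_i]; first by rewrite l1.2 ?mul0r.
rewrite l2.2 ?mulr0 // ltNge; apply/negP => le_j.
by have := lt_le_trans lt_m (lem_add le_i le_j); rewrite -e ltxx.
Qed.

Lemma lead_at1 : lead_at 0%MM (1 : fps n k).
Proof. by rewrite -fpsX0; apply: lead_atX. Qed.

Lemma lead_atXn m f j : lead_at m f -> lead_at (m *+ j)%MM (f ^+ j).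
Proof.
move=> lf; elim: j => [|j IH]; first by rewrite mulm0n; apply: lead_at1.
by rewrite mulmS exprS; apply: lead_atM.
Qed.

Lemma lead_at_inj m m' f : lead_at m f -> lead_at m' f -> m = m'.
Proof.
move=> [nz lo] [nz' lo']; case: (ltgtP m m') => // lt.
  by rewrite lo' ?eqxx in nz.
by rewrite lo ?eqxx in nz'.
Qed.

Lemma fps_idomain_axiom : GRing.integral_domain_axiom (fps n k).
Proof.
move=> f g /eqP fg0; apply/negPn; rewrite negb_or; apply/negP => /andP[nf ng].
have [[m1 l1] [m2 l2]] := (lead_at_exists nf, lead_at_exists ng).
by have := lead_at_neq0 (lead_atM l1 l2); rewrite fg0.
Qed.

HB.instance Definition _ :=
  GRing.ComUnitRing_isIntegral.Build (fps n k) fps_idomain_axiom.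

(** Division of a power series by finitely many others: no monomial of the
    remainder is divisible by a leading monomial of the divisors. The
    quotients are found one coefficient at a time: [c m] is what the first
    divisor whose leading monomial divides [m] has to contribute in order to
    cancel the monomial [m], and it depends on the [c m'] with [m' < m]
    only. *)
Lemma fps_division (s : nat) (g : 'I_s -> fps n k) (mu : 'I_s -> 'X_{1..n}) f :
  (forall i, lead_at (mu i) (g i)) ->
  exists (q : 'I_s -> fps n k) (r : fps n k),
    f = \sum_i q i * g i + r /\
    forall m i, (mu i <= m)%MM -> r m = 0.
Proof.
move=> lg; pose first m : option 'I_s := [pick i | (mu i <= m)%MM].
pose tail m (c : forall m', (m' < m)%O -> k) : k :=
  \sum_(i < s)
   \sum_(ij : 'X_{1..n < (mdeg m).+1, (mdeg m).+1} | m == (ij.1 + ij.2)%MM)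
     (if pselect ((ij.1 + mu i)%MM < m)%O is left lt then
        if first (ij.1 + mu i)%MM == Some i then c _ lt * g i ij.2 else 0
      else 0).
pose step m c := if first m is Some i then (g i (mu i))^-1 * (f m - tail m c)
                 else 0.
pose c := Fix (@ltom_wf n) (fun=> k) step.
have cE m : c m = step m (fun m' _ => c m').
  rewrite /c Fix_eq // => x u v uv; congr step.
  by apply: functional_extensionality_dep => y;
     apply: functional_extensionality_dep => p; apply: uv.
pose q i := Fps (fun m => if first (m + mu i)%MM == Some i
                          then c (m + mu i)%MM else 0).
exists q, (f - \sum_i q i * g i); split; first by rewrite addrC subrK.
move=> m i0 le_m; rewrite fpsBE fps_sumE; apply/eqP; rewrite subr_eq0; apply/eqP.
have [i fi le_i] : exists2 i, first m = Some i & (mu i <= m)%MM.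
  rewrite /first; case: pickP => [i le_i|/(_ i0)]; first by exists i.
  by rewrite le_m.
have gi : g i (mu i) != 0 by case: (lg i).
suff -> : \sum_i (q i * g i) m = tail m (fun m' _ => c m') + c m * g i (mu i).
  by rewrite cE /step fi mulrC mulVKf // addrC subrK.
have -> : c m * g i (mu i) = \sum_j (if j == i then c m * g i (mu i) else 0).
  by rewrite -big_mkcond big_pred1_eq.
rewrite /tail -big_split /=; apply: eq_bigr => j _.
(* For a pair (a, b) of product m, compare a * lead (g j) with m: the larger
   ones do not contribute, equality is the leading term itself. *)
have term (ij : 'X_{1..n < (mdeg m).+1, (mdeg m).+1}) :
    m == (ij.1 + ij.2)%MM -> (ij.1 + mu j)%MM != m \/ j != i ->
  q j ij.1 * g j ij.2 =
    (if pselect ((ij.1 + mu j)%MM < m)%O is left lt then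
       if first (ij.1 + mu j)%MM == Some j then c (ij.1 + mu j)%MM * g j ij.2 else 0
     else 0).
  move=> /eqP e ne; case: pselect => [lt|nlt] /=.
    by case: ifP => _ //; rewrite mul0r.
  have [lt|gt|eq] := ltgtP (ij.1 + mu j)%MM m => //.
    rewrite (lg j).2 ?mulr0 // ltNge; apply/negP => le.
    by move: gt; rewrite {1}e ltmc_add2r ltNge le.
  case: ne => [|ne]; first by rewrite eq eqxx.
  by rewrite eq fi; case: eqP => [[]/esym/eqP|_]; rewrite ?(negPf ne) ?mul0r.
case: (eqVneq j i) => [eji|nji]; last first.
  by rewrite addr0; apply: eq_bigr => ij e; apply: term e _; right.
have b1 : (mdeg (m - mu i) < (mdeg m).+1)%N by rewrite ltnS mdegB.
have b2 : (mdeg (mu i) < (mdeg m).+1)%N.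
  by rewrite ltnS -[in X in (_ <= X)%N](submK le_i) mdegD leq_addl.
pose ij0 := (BMultinom b1, BMultinom b2) : 'X_{1..n < (mdeg m).+1, (mdeg m).+1}.
have P0 : m == (ij0.1 + ij0.2)%MM by rewrite /= submK.
rewrite (bigD1 ij0) //= [X in _ = X + _](bigD1 ij0) //=.
case: pselect => [lt|_] /=.
  by exfalso; move: lt; rewrite eji submK // ltxx.
rewrite add0r addrC; congr (_ + _); last first.
  by rewrite eji submK // fi eqxx.
apply: eq_bigr => -[u v] /andP[e ne]; apply: (term _ e); left.
rewrite eji; apply: contraNneq ne => eu; apply/eqP; congr pair; apply: val_inj => /=.
  exact: mnmD_eql eu.
by apply: (@mnmD_eqr _ (m - mu i)%MM (mu i) u v); [apply: etrans (submK le_i) (eqP e)|exact: mnmD_eql eu].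
Qed.

End Leading.

(** * Ideals *)

Section IdealTheory.
Variable R : comPzRingType.
Implicit Types (I J p q : ideal R) (x y : R).

Lemma ideal_mulr I x a : I x -> I (x * a).
Proof. by rewrite mulrC; apply: ideal_mul. Qed.

Lemma ideal_opp I x : I x -> I (- x).
Proof. by rewrite -mulN1r; apply: ideal_mul. Qed.

Lemma ideal_sub I x y : I x -> I y -> I (x - y).
Proof. by move=> Ix Iy; apply: ideal_add => //; apply: ideal_opp. Qed.

Lemma ideal_addl I x y : I x -> I (x + y) -> I y.
Proof. by move=> Ix Ixy; rewrite -(addKr x y); apply: ideal_add => //; apply: ideal_opp. Qed.

Lemma ideal_sum I (T : Type) (r : seq T) (P : pred T) (F : T -> R) :
  (forall i, P i -> I (F i)) -> I (\sum_(i <- r | P i) F i).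
Proof.
by move=> IF; elim/big_ind: _ => //; [apply: ideal_zero | apply: ideal_add].
Qed.

Lemma ideal_setE I J : (forall x, I x <-> J x) -> I = J :> set R.
Proof. by move=> IJ; apply/funext => x; apply/propext. Qed.

Lemma ideal_ext I J : I = J :> set R -> forall x, I x <-> J x.
Proof. by move=> IJ x; rewrite IJ. Qed.

Lemma prime_expr p x m : prime_ideal p -> p (x ^+ m) -> p x.
Proof.
case=> np1 pp; elim: m => [|m IH]; first by rewrite expr0.
by rewrite exprS => /pp[].
Qed.

Lemma generated_sub (S : set R) I : S `<=` I -> generated S `<=` I.
Proof. by move=> SI x; apply. Qed.

Lemma generated_in (S : set R) : S `<=` generated S.
Proof. by move=> x Sx I; apply. Qed.

Definition span_set r (a : 'I_r -> R) : set R :=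
  [set x | exists c, x = \sum_i c i * a i].

Fact span_zero r (a : 'I_r -> R) : span_set a 0.
Proof. by exists (fun=> 0); rewrite big1 // => i _; rewrite mul0r. Qed.

Fact span_add r (a : 'I_r -> R) x y :
  span_set a x -> span_set a y -> span_set a (x + y).
Proof.
move=> [c ->] [d ->]; exists (fun i => c i + d i).
by rewrite -big_split; apply: eq_bigr => i _; rewrite mulrDl.
Qed.

Fact span_mul r (a : 'I_r -> R) b x : span_set a x -> span_set a (b * x).
Proof.
move=> [c ->]; exists (fun i => b * c i).
by rewrite mulr_sumr; apply: eq_bigr => i _; rewrite mulrA.
Qed.

Definition span_ideal r (a : 'I_r -> R) : ideal R :=
  Ideal (@span_zero r a) (@span_add r a) (@span_mul r a).

Lemma span_gen r (a : 'I_r -> R) i : span_ideal a (a i).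
Proof.
exists (fun j => (j == i)%:R); rewrite (bigD1 i) //= eqxx mul1r big1 ?addr0 // => j.
by move=> /negPf ->; rewrite mul0r.
Qed.

Lemma generated_rangeE r (a : 'I_r -> R) : generated (range a) = span_ideal a :> set R.
Proof.
apply: ideal_setE => x; split; first by apply: generated_sub => _ [i _ <-]; apply: span_gen.
case=> c ->; apply: ideal_sum => i _; apply: ideal_mul; apply: generated_in.
by exists i.
Qed.

Lemma generated1E g x : generated [set g] x <-> exists c, x = c * g.
Proof.
split=> [gx|[c ->]]; last by apply: ideal_mul; apply: generated_in.
have : span_ideal (fun _ : 'I_1 => g) x.
  by apply: gx => _ ->; exact: (span_gen _ ord0).
by case=> c ->; exists (c ord0); rewrite big_ord1.
Qed.

Lemma generated_byE I r :
  generated_by I r <-> exists a : 'I_r -> R, forall x, I x <-> span_ideal a x.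
Proof.
split=> -[a e]; exists a; first by move=> x; rewrite e generated_rangeE.
by rewrite generated_rangeE; apply: ideal_setE.
Qed.

Definition adjoin I (z : R) : ideal R.
Proof.
refine (@Ideal R [set w | exists a b, I a /\ w = a + b * z] _ _ _) => /=.
- by exists 0, 0; rewrite mul0r addr0; split=> //; apply: ideal_zero.
- move=> _ _ [a [b [Ia ->]]] [a' [b' [Ia' ->]]]; exists (a + a'), (b + b').
  by split; [apply: ideal_add | rewrite mulrDl addrACA].
- move=> c _ [a [b [Ia ->]]]; exists (c * a), (c * b).
  by split; [apply: ideal_mul | rewrite mulrDr mulrA].
Defined.

Definition colon I (s : R) : ideal R.
Proof.
refine (@Ideal R [set y | I (y * s)] _ _ _) => /=.
- by rewrite mul0r; apply: ideal_zero.
- by move=> x y Ix Iy; rewrite mulrDl; apply: ideal_add.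
- by move=> a x Ix; rewrite -mulrA; apply: ideal_mul.
Defined.

Definition ideal0 : ideal R.
Proof.
by refine (@Ideal R [set 0] _ _ _) => // [x y -> ->|a x ->] /=;
  rewrite ?addr0 ?mulr0.
Defined.

End IdealTheory.

Section Preimage.
Variables (R S : comPzRingType) (h : {rmorphism R -> S}).
Implicit Types (I J : ideal S).

Definition preim_ideal I : ideal R.
Proof.
refine (@Ideal R (h @^-1` I) _ _ _) => [|x y|a x] /=.
- by rewrite rmorph0; apply: ideal_zero.
- by rewrite rmorphD; apply: ideal_add.
- by rewrite rmorphM; apply: ideal_mul.
Defined.

Lemma preim_prime I : prime_ideal I -> prime_ideal (preim_ideal I).
Proof.
case=> nI1 pI; split=> [|x y] /=; rewrite /preimage /= ?rmorph1 //.
by rewrite rmorphM; apply: pI.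
Qed.

End Preimage.

(** * Primes in Noetherian rings *)

Section Noetherian.
Variable R : comPzRingType.
Implicit Types (I J p q : ideal R) (x y : R).

(** Otherwise dependent choice gives a strictly increasing sequence of ideals,
    whose union is finitely generated. *)
Lemma noetherian_maximal (P : ideal R -> Prop) I0 : noetherian R -> P I0 ->
  exists2 I, P I & forall J, P J -> I `<=` J -> J `<=` I.
Proof.
move=> noeth P0; apply: contrapT => nomax.
have next (I : {I : ideal R | P I}) :
    {J : {I : ideal R | P I} | sval I `<=` sval J & ~ (sval J `<=` sval I)}.
  apply: cid2; apply: contrapT => no; apply: nomax; exists (sval I); first exact: svalP.
  move=> J PJ IJ; apply: contrapT => nJI; apply: no.
  by exists (exist _ J PJ).
pose c := fix c i := if i is j.+1 then s2val (next (c j)) else exist _ I0 P0.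
have c_sub i : sval (c i) `<=` sval (c i.+1) by exact: (s2valP (next (c i))).
have c_mono i j : (i <= j)%N -> sval (c i) `<=` sval (c j).
  move=> /subnK <-; elim: (j - i)%N => // d IH x /IH; exact: c_sub.
have U0 : [set x | exists i, sval (c i) x] 0 by exists 0%N; apply: ideal_zero.
have UD x y : (exists i, sval (c i) x) -> (exists i, sval (c i) y) ->
    exists i, sval (c i) (x + y).
  move=> [i ix] [j jy]; exists (maxn i j); apply: ideal_add.
    by apply: c_mono ix; apply: leq_maxl.
  by apply: c_mono jy; apply: leq_maxr.
have UM a x : (exists i, sval (c i) x) -> exists i, sval (c i) (a * x).
  by move=> [i ix]; exists i; apply: ideal_mul.
pose U := Ideal U0 UD UM.
have [r /generated_byE[a aU]] := noeth U.
have /choice[f fa] : forall i, exists j, sval (c j) (a i).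
  by move=> i; apply/(aU (a i)); apply: span_gen.
pose N := \max_i f i.
have UN : U `<=` sval (c N).
  move=> x /aU[b ->]; apply: ideal_sum => i _; apply: ideal_mul.
  by apply: c_mono (fa i); apply: leq_bigmax.
apply: (s2valP' (next (c N))) => x cx; apply: UN.
by exists N.+1.
Qed.

(** Take p maximal among the ideals that contain I and avoid S. *)
Lemma prime_avoiding (S : set R) I : noetherian R ->
  S 1 -> (forall x y, S x -> S y -> S (x * y)) ->
  (forall x, I x -> ~ S x) ->
  exists p, [/\ prime_ideal p, I `<=` p & forall x, p x -> ~ S x].
Proof.
move=> noeth S1 SM IS.
have [p [Ip pS] pmax] := @noetherian_maximal
  (fun J => I `<=` J /\ forall x, J x -> ~ S x) I noeth (conj (fun _ => id) IS).
exists p; split=> //; split=> [p1|x y pxy]; first exact: pS p1 S1.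
(* If [p] contains neither x nor y, then p + (x) and p + (y) both meet S. *)
have meets z : ~ p z -> exists a b, p a /\ S (a + b * z).
  move=> npz; apply: contrapT => no.
  have pq : p `<=` adjoin p z by move=> a pa; exists a, 0; rewrite mul0r addr0.
  apply: npz; apply: (pmax (adjoin p z)) => //; last first.
    by exists 0, 1; rewrite mul1r add0r; split=> //; apply: ideal_zero.
  split=> [w Iw|w [a [b [pa ->]]] Sw]; first by apply: pq; apply: Ip.
  by apply: no; exists a, b.
apply: contrapT => /not_orP[/meets[a [b [pa Sa]]] /meets[a' [b' [pa' Sa']]]].
apply: (pS _ _ (SM _ _ Sa Sa')).
rewrite mulrDl mulrDr; apply: ideal_add; last rewrite mulrDr; last apply: ideal_add.
- by apply: ideal_add; rewrite ?[a * (b' * y)]mulrC; [apply: ideal_mul | apply: ideal_mul].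
- exact: ideal_mul.
- by rewrite mulrACA; apply: ideal_mul.
Qed.

(** Take p maximal among the annihilators of the nonzero multiples of the residue
    of r modulo J. *)
Lemma prime_colon J r : noetherian R -> ~ J r ->
  exists p s, [/\ prime_ideal p, forall y, p y <-> J (y * s)
                & forall y, J (y * r) -> p y].
Proof.
move=> noeth nJr.
pose P I := exists s, ~ J (s * r) /\ forall y, I y <-> J (y * (s * r)).
have P0 : P (colon J r) by exists 1; rewrite mul1r.
have [p [s [nJs pE]] pmax] := noetherian_maximal noeth P0.
exists p, (s * r); split=> //; last first.
  by move=> y Jy; apply/pE; rewrite mulrCA; apply: ideal_mul.
split=> [/pE|x y pxy]; first by rewrite mul1r.
have [Jy|nJy] := pselect (J (y * (s * r))); first by right; apply/pE.
left; apply: (pmax (colon J (y * (s * r)))); last 1 first.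
- by move/pE: pxy; rewrite -mulrA.
- by exists (y * s); rewrite -mulrA.
- by move=> z /pE Jz; rewrite /= mulrCA; apply: ideal_mul.
Qed.

End Noetherian.

(** * Units, the maximal ideal and orders *)

Section Division.
Variables (n : nat) (k : fieldType).
Implicit Types (f g q r : fps n k) (m mu : 'X_{1..n}) (d e : nat).

Lemma fps_division1 g mu f : lead_at mu g ->
  exists q r, f = q * g + r /\ forall m, (mu <= m)%MM -> r m = 0.
Proof.
move=> lg; have [q [r [fE rE]]] :=
  @fps_division n k 1 (fun=> g) (fun=> mu) f (fun=> lg).
exists (q ord0), r; rewrite fE big_ord1; split=> // m.
exact: (rE m ord0).
Qed.

Lemma fps_division_uniq g mu q : lead_at mu g ->
  (forall m, (mu <= m)%MM -> (q * g) m = 0) -> q = 0.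
Proof.
move=> lg qg; apply: contrapT => /eqP /lead_at_exists[m lq].
have [+ _] := lead_atM lq lg.
by rewrite qg ?eqxx ?lem_addl.
Qed.

Lemma lead_at_const f : f 0%MM != 0 -> lead_at 0%MM f.
Proof. by move=> nz; split=> // m; rewrite ltNge le0x. Qed.

Lemma fps_unitE f : (f \is a GRing.unit) = (f 0%MM != 0).
Proof.
apply/idP/idP => [/divrr fV|nz].
  apply/eqP => f0; have := congr1 (fun g : fps n k => g 0%MM) fV.
  rewrite fpsME big1 => [|[[i ?] [j ?]] /= /eqP/esym/eqP].
    by move/eqP; rewrite fps1E eqxx eq_sym oner_eq0.
  by rewrite mnmD_eq0 => /andP[/eqP-> _]; rewrite f0 mul0r.
have [q [r [qE rE]]] := fps_division1 1 (lead_at_const nz).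
apply/unitrPr; exists q; rewrite mulrC.
suff -> : q * f = 1 by [].
rewrite qE; have -> : r = 0; last by rewrite addr0.
by apply: fpsP => m; rewrite rE //; apply/mnm_lepP => i; rewrite mnm0E.
Qed.

Lemma fps_const0M f g : (f * g) 0%MM = f 0%MM * g 0%MM.
Proof.
rewrite fpsME (bigD1 (bm0, bm0)) /=; last by rewrite addm0.
rewrite big1 ?addr0 // => -[i j] /= /andP[/eqP/esym/eqP].
rewrite mnmD_eq0 => /andP[/eqP i0 /eqP j0] /eqP[]; congr pair; exact: val_inj.
Qed.

Definition fps_max : ideal (fps n k).
Proof.
refine (@Ideal (fps n k) [set f : fps n k | f 0%MM = 0] _ _ _).
- by [].
- by move=> f g f0 g0; rewrite /= f0 g0 addr0.
- by move=> f g g0; rewrite /mkset fps_const0M g0 mulr0.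
Defined.

Lemma fps_max_sup (I : ideal (fps n k)) f : ~ I 1 -> I f -> fps_max f.
Proof.
move=> nI1 If; apply: contrapT => /eqP; rewrite -fps_unitE => /divrr ff.
by apply: nI1; rewrite -ff; apply: ideal_mulr.
Qed.

Lemma fps_max_neq1 : ~ fps_max 1.
Proof. by move/eqP; rewrite fps1E eqxx oner_eq0. Qed.

Lemma fps_max_gen f : fps_max f <-> span_ideal (fun i : 'I_n => fpsX k U_(i)%MM) f.
Proof.
split=> [f0|[c ->]]; last first.
  rewrite /fps_max /= fps_sumE big1 // => i _.
  by rewrite fps_const0M [X in _ * X]/= eq_sym mnm1_eq0 mulr0.
have [q [r [fE rE]]] := @fps_division n k n (fun i : 'I_n => fpsX k U_(i)%MM)
  (fun i => U_(i)%MM) f (fun i => lead_atX k _).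
exists q; rewrite {1}fE; have -> : r = 0; last by rewrite addr0.
apply: fpsP => m; rewrite fps0E; have [->|] := eqVneq m 0%MM; last first.
  rewrite -mdeg_eq0 mdegE sum_nat_eq0 => /forallPn[i /=]; rewrite -lep1mP; exact: rE.
have := f0 : f 0%MM = 0; rewrite fE fpsDE fps_sumE big1 ?add0r // => i _.
by rewrite fps_const0M [X in _ * X]/= eq_sym mnm1_eq0 mulr0.
Qed.

(** The d-th power of the maximal ideal. *)
Definition order_ge d f : Prop := forall m, (mdeg m < d)%N -> f m = 0.

Lemma order_geD d f g : order_ge d f -> order_ge d g -> order_ge d (f + g).
Proof. by move=> df dg m lt; rewrite fpsDE df ?dg ?addr0. Qed.

Lemma order_geM d e f g : order_ge d f -> order_ge e g -> order_ge (d + e) (f * g).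
Proof.
move=> df eg m lt; rewrite fpsME big1 // => -[i j] /= /eqP ij.
have lt' : (mdeg i + mdeg j < d + e)%N by rewrite -mdegD -ij.
case: (ltnP (mdeg i) d) => [lti|lei]; first by rewrite df ?mul0r.
by rewrite eg ?mulr0 //; lia.
Qed.

Lemma order_ge0 f : order_ge 0 f. Proof. by []. Qed.

Lemma order_geMl d f g : order_ge d g -> order_ge d (f * g).
Proof. by move=> dg; have := order_geM (order_ge0 f) dg. Qed.

Lemma order_ge1 f : order_ge 1 f <-> fps_max f.
Proof.
split=> [f1|f0 m]; first by apply: f1; rewrite mdeg0.
by rewrite ltnS leqn0 mdeg_eq0 => /eqP ->.
Qed.

Lemma order_geXn d e f : order_ge d f -> order_ge (d * e) (f ^+ e).
Proof.
move=> df; elim: e => [|e IH]; first by rewrite muln0; apply: order_ge0.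
by rewrite exprS mulnS; apply: order_geM.
Qed.

Lemma lead_order_ge m f : lead_at m f -> order_ge (mdeg m) f.
Proof. by move=> lf m'; apply: lead_at_mdeg. Qed.

Lemma order_ge_lead d m f : order_ge d f -> lead_at m f -> (d <= mdeg m)%N.
Proof.
by move=> df [nz _]; rewrite leqNgt; apply: contraNN nz => /df ->.
Qed.

End Division.

(** * Power series rings are Noetherian *)

Section Dickson.

Lemma monotone_subsequence (u : nat -> nat) :
  exists phi : nat -> nat, (forall i j, (i < j)%N -> (phi i < phi j)%N) /\
    forall i j, (i <= j)%N -> (u (phi i) <= u (phi j))%N.
Proof.
(* Visit successively the least values of the tails of u. *)
have /choice[best bestP] : forall N, exists j,
    (N <= j)%N /\ forall l, (N <= l)%N -> (u j <= u l)%N.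
  move=> N; have exv : exists v, `[< exists2 j, (N <= j)%N & u j = v >].
    by exists (u N); apply/asboolP; exists N.
  case: (ex_minnP exv) => v /asboolP[j Nj <-] vmin.
  by exists j; split=> // l Nl; apply: vmin; apply/asboolP; exists l.
pose phi := fix phi i := if i is j.+1 then best (phi j).+1 else best 0%N.
have phiS i : (phi i < phi i.+1)%N by case: (bestP (phi i).+1).
exists phi; split.
  move=> i j /subnK <-; elim: (j - i.+1)%N => [|d IH]; first exact: phiS.
  by apply: leq_trans IH (ltnW _); apply: phiS.
have uS i : (u (phi i) <= u (phi i.+1))%N.
  case: i => [|i]; first by apply: (bestP 0%N).2.
  apply: (bestP (phi i).+1).2.
  by apply: leq_trans (phiS i) (ltnW _); apply: phiS.
move=> i j /subnK <-; elim: (j - i)%N => // d IH.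
exact: leq_trans IH (uS _).
Qed.

(** Take nondecreasing subsequences for one coordinate after the other. *)
Lemma dickson n (s : nat -> 'X_{1..n}) : exists i j, (i < j)%N /\ (s i <= s j)%MM.
Proof.
suff [phi [phi_mono sphi]] : exists phi : nat -> nat,
    (forall i j, (i < j)%N -> (phi i < phi j)%N) /\
    forall l, l \in enum 'I_n -> forall i j, (i <= j)%N -> (s (phi i) l <= s (phi j) l)%N.
  exists (phi 0%N), (phi 1%N); split; first exact: phi_mono.
  by apply/mnm_lepP => l; apply: sphi => //; rewrite mem_enum.
elim: (enum 'I_n) => [|l ls [phi [phi_mono IH]]]; first by exists id.
have [psi [psi_mono sl]] := monotone_subsequence (fun i => s (phi i) l).
exists (phi \o psi); split=> [i j /psi_mono/phi_mono //|l'].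
rewrite in_cons => /predU1P[->|l'ls] i j le_ij; first exact: sl.
apply: IH => //; move: le_ij; rewrite leq_eqVlt => /predU1P[-> //|/psi_mono].
exact: ltnW.
Qed.

End Dickson.

Section FpsNoetherian.
Variables (n : nat) (k : fieldType).

(** If the leading monomials of some elements of I generate all those of I,
    then the remainder of an element of I has no leading monomial, so that it
    vanishes. By Dickson's lemma, finitely many elements suffice. *)
Lemma fps_noetherian : noetherian (fps n k).
Proof.
move=> I; apply: contrapT => nfg.
pose good (x : fps n k * 'X_{1..n}) := I x.1 /\ lead_at x.2 x.1.
have next (s : seq (fps n k * 'X_{1..n})) : {x | (forall y, y \in s -> good y) ->
    good x /\ forall y, y \in s -> ~~ (y.2 <= x.2)%MM}.
  apply: cid; apply: contrapT => no; apply: nfg.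
  have gs y : y \in s -> good y.
    by apply: contraPP => ngy ys; apply: no; exists (0, 0%MM) => /(_ _ ys).
  pose g (i : 'I_(size s)) := (tnth (in_tuple s) i).1.
  pose mu (i : 'I_(size s)) := (tnth (in_tuple s) i).2.
  have Ig i : I (g i) by case: (gs _ (mem_tnth i (in_tuple s))).
  have lg i : lead_at (mu i) (g i) by case: (gs _ (mem_tnth i (in_tuple s))).
  exists (size s); apply/generated_byE; exists g => f; split=> [If|[c ->]]; last first.
    by apply: ideal_sum => i _; apply: ideal_mul.
  have [q [r [fE rE]]] := fps_division f lg.
  exists q; rewrite fE; suff -> : r = 0 by rewrite addr0.
  have Ir : I r.
    apply: (@ideal_addl _ _ (\sum_i q i * g i)); last by rewrite -fE.
    by apply: ideal_sum => i _; apply: ideal_mul.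
  apply: contrapT => /eqP /lead_at_exists[m lr]; apply: no.
  exists (r, m) => _; split=> // y /(@tnthP _ _ (in_tuple s))[i ->] /=.
  by apply/negP => le_m; case/eqP: (lr.1); apply: (rE m i).
pose L := fix L i := if i is j.+1 then sval (next (L j)) :: L j else [::].
have Lgood i : forall y, y \in L i -> good y.
  elim: i => // i IH y; rewrite in_cons => /predU1P[->|/IH //].
  by case: (svalP (next (L i)) IH).
have [i [j [lt_ij le_ij]]] := dickson (fun i => (sval (next (L i))).2).
have [_ above] := svalP (next (L j)) (Lgood j).
suff /above : sval (next (L i)) \in L j by rewrite le_ij.
move: lt_ij => /subnK <-.
elim: (j - i.+1)%N => [|d IH]; first exact: mem_head.
by rewrite addSn /= in_cons IH orbT.
Qed.

End FpsNoetherian.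

(** * Power series rings are completely integrally closed *)

(** The hypothesis says that the fraction a/b is almost integral, c being a common
    denominator of its powers; subtracting a ring element q preserves this. *)
Lemma almost_integral_sub (R : comPzRingType) (a b c q : R) :
  (forall m, exists r, c * a ^+ m = b ^+ m * r) ->
  forall m, exists r, c * (a - q * b) ^+ m = b ^+ m * r.
Proof.
move=> /choice[s sE] m.
exists (\sum_(i < m.+1) ((-1) ^+ i * s (m - i)%N * q ^+ i) *+ 'C(m, i)).
rewrite exprBn !mulr_sumr; apply: eq_bigr => i _.
rewrite !mulrnAr; congr (_ *+ _).
have -> : c * ((-1) ^+ i * a ^+ (m - i) * (q * b) ^+ i) =
          (c * a ^+ (m - i)) * ((-1) ^+ i * (q * b) ^+ i) by ring.
have -> : b ^+ m = b ^+ (m - i) * b ^+ i by rewrite -exprD subnK // -ltnS.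
by rewrite sE exprMn; ring.
Qed.

Section CompletelyIntegrallyClosed.
Variables (n : nat) (k : fieldType).
Implicit Types a b c : fps n k.

(** Divide a by b with remainder r: all the b^m divide c r^m as well. If r
    were nonzero, comparing exponents of leading monomials for large m would
    show that the leading monomial of b divides that of r. *)
Lemma fps_completely_integrally_closed a b c : b != 0 -> c != 0 ->
  (forall m, exists r, c * a ^+ m = b ^+ m * r) -> exists q, a = q * b.
Proof.
move=> nb nc ab; have [beta lb] := lead_at_exists nb.
have [gamma lc] := lead_at_exists nc.
have [q [r [aE rE]]] := fps_division1 a lb.
exists q; rewrite aE; suff -> : r = 0 by rewrite addr0.
apply: contrapT => /eqP nr; have [nu lr] := lead_at_exists nr.
have rb := almost_integral_sub q ab; rewrite aE [_ + r]addrC addrK in rb.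
case/eqP: (lr.1); apply: rE; apply/mnm_lepP => i.
have [s sE] := rb (gamma i).+1.
have ns : s != 0.
  apply: contraTneq isT => s0; move/eqP: sE; rewrite s0 mulr0 mulf_eq0.
  by rewrite (negPf nc) expf_eq0 (negPf nr) andbF.
have [sigma ls] := lead_at_exists ns.
have l1 := lead_atM lc (lead_atXn (gamma i).+1 lr).
have l2 := lead_atM (lead_atXn (gamma i).+1 lb) ls.
rewrite sE in l1; have /mnmP/(_ i) := lead_at_inj l1 l2.
rewrite !mnmDE !mulmnE; nia.
Qed.

End CompletelyIntegrallyClosed.

(** * Power series in one more variable *)

Section Widen.
Variables (n : nat) (k : fieldType).
Local Notation A := (fps n k).
Local Notation R := (fps n.+1 k).
Local Notation widen := (widen_ord (leqnSn n)).
Implicit Types (a b : A) (f g q : R) (m : 'X_{1..n.+1}) (c : nat -> A).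

Definition mnmnarrow m : 'X_{1..n} := [multinom m (widen i) | i < n].

Lemma mnmwidenK (m : 'X_{1..n}) i :
  mnmnarrow (mnmwiden m + U_(ord_max) *+ i)%MM = m.
Proof.
apply/mnmP => j; rewrite mnmE mnmDE mnmwiden_widen mulmnE mnm1E.
by rewrite -val_eqE /= gtn_eqF // addn0.
Qed.

Lemma mnmwiden_last (m : 'X_{1..n}) i :
  (mnmwiden m + U_(ord_max) *+ i)%MM ord_max = i.
Proof. by rewrite mnmDE mnmwiden_ordmax mulmnE mnm1E eqxx mul1n. Qed.

Lemma ord_lastP (i : 'I_n.+1) : i = ord_max \/ exists j, i = widen j.
Proof.
have [lt|ge] := ltnP i n; last by left; apply: val_inj => /=; have := ltn_ord i; lia.
by right; exists (Ordinal lt); apply: val_inj.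
Qed.

Lemma mnmnarrowK m : (mnmwiden (mnmnarrow m) + U_(ord_max) *+ m ord_max)%MM = m.
Proof.
apply/mnmP => i; have [->|[j ->]] := ord_lastP i; first exact: mnmwiden_last.
rewrite mnmDE mnmwiden_widen mulmnE mnm1E -val_eqE /= gtn_eqF // addn0.
by rewrite mnmE.
Qed.

Lemma mdeg_mnmwiden (m : 'X_{1..n}) : mdeg (mnmwiden m) = mdeg m.
Proof.
rewrite !mdegE big_ord_recr /= mnmwiden_ordmax addn0.
by apply: eq_bigr => i _; rewrite mnmwiden_widen.
Qed.

Definition fps_widen a : R :=
  Fps (fun m => if m ord_max == 0%N then a (mnmnarrow m) else 0).

Lemma agree_widen d a p : agree d a p -> agree d (fps_widen a) (mwiden p).
Proof.
move=> ap m lt /=; case: eqP => [m0|mn0].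
  have mE : m = mnmwiden (mnmnarrow m) by rewrite -[LHS]mnmnarrowK m0 mulm0n addm0.
  by rewrite [in RHS]mE mwiden_mnmwiden ap // -mdeg_mnmwiden -mE.
rewrite (mwidenE (leqnn _)) raddf_sum big1 // => i _ /=.
rewrite mcoeffZ mcoeffX; case: eqP => [e|]; last by rewrite mulr0.
by case: mn0; rewrite -e mnmwiden_ordmax.
Qed.

Fact fps_widen_is_zmod_morphism : zmod_morphism fps_widen.
Proof.
by move=> a b; apply: fpsP => m; rewrite fpsBE /=; case: ifP; rewrite ?subr0.
Qed.

Fact fps_widen_is_monoid_morphism : monoid_morphism fps_widen.
Proof.
split=> [|a b]; apply: fpsP => m.
  rewrite !fps1E /=; case: eqP => [m0|mn0]; rewrite ?fps1E.
    congr ((_ : bool)%:R); apply/eqP/eqP => [e|->].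
      by rewrite -(mnmnarrowK m) m0 mulm0n addm0 e mnmwiden0.
    by apply/mnmP => i; rewrite mnmE !mnm0E.
  by case: eqP => // e; case: mn0; rewrite e mnm0E.
have [Aa Ab] := (@agree_truncate _ _ (mdeg m).+1 a, @agree_truncate _ _ (mdeg m).+1 b).
rewrite (agree_widen (agreeM Aa Ab)) // mwidenM.
by rewrite (agreeM (agree_widen Aa) (agree_widen Ab)).
Qed.

HB.instance Definition _ :=
  GRing.isZmodMorphism.Build A R fps_widen fps_widen_is_zmod_morphism.
HB.instance Definition _ :=
  GRing.isMonoidMorphism.Build A R fps_widen fps_widen_is_monoid_morphism.

Definition xlast : R := fpsX k U_(ord_max)%MM.

Lemma widen_xlastE a i m :
  (fps_widen a * xlast ^+ i) m = if m ord_max == i then a (mnmnarrow m) else 0.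
Proof.
rewrite mulrC fpsXn fpsXM; case: ifP => [/mnm_lepP le|nle].
  have := le ord_max; rewrite mulmnE mnm1E eqxx mul1n => le_i.
  rewrite /= mnmBE mulmnE mnm1E eqxx mul1n subn_eq0.
  have -> : (m ord_max <= i)%N = (m ord_max == i) by rewrite eqn_leq le_i andbT.
  case: ifP => // _; congr (a _); apply/mnmP => j.
  by rewrite [LHS]mnmE [RHS]mnmE mnmBE mulmnE mnm1E -val_eqE /= gtn_eqF // subn0.
case: eqP => // e; case/negP: nle; apply/mnm_lepP => j.
rewrite mulmnE mnm1E; case: eqP => [<-|_]; last by rewrite mul0n.
by rewrite mul1n e.
Qed.

(** The remainders of Weierstrass division. The coefficients are indexed by nat
    so that the degree bound d can vary without casts. *)
Definition low d c : R := \sum_(i < d) fps_widen (c i) * xlast ^+ i.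

Lemma lowE d c m :
  low d c m = if (m ord_max < d)%N then c (m ord_max) (mnmnarrow m) else 0.
Proof.
rewrite fps_sumE; case: ifP => [lt|ge].
  rewrite (bigD1 (Ordinal lt)) // widen_xlastE eqxx big1; first exact: addr0.
  move=> i ne; rewrite widen_xlastE; case: eqP => // e; case/eqP: ne; exact: val_inj.
rewrite big1 // => i _; rewrite widen_xlastE; case: eqP => // e.
by rewrite e ltn_ord in ge.
Qed.

Lemma lowM d a c : fps_widen a * low d c = low d (fun i => a * c i).
Proof. by rewrite mulr_sumr; apply: eq_bigr => i _; rewrite rmorphM mulrA. Qed.

Lemma low0 d : low d (fun=> 0) = 0.
Proof. by rewrite /low big1 // => i _; rewrite rmorph0 mul0r. Qed.

Lemma eq_low d c c' : (forall i, (i < d)%N -> c i = c' i) -> low d c = low d c'.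
Proof. by move=> cc'; apply: eq_bigr => i _; rewrite cc'. Qed.

Lemma low_inj d c : low d c = 0 -> forall i, (i < d)%N -> c i = 0.
Proof.
move=> c0 i lt; apply: fpsP => m; rewrite fps0E.
have := lowE d c (mnmwiden m + U_(ord_max) *+ i)%MM.
by rewrite c0 mnmwiden_last lt mnmwidenK => <-.
Qed.

Lemma low1 a : low 1 (fun=> a) = fps_widen a.
Proof. by rewrite /low big_ord1 expr0 mulr1. Qed.

(** The monomial order makes xlast^d the least monomial of its degree, so this
    says that f has order d and is regular of that order in xlast. *)
Definition regular_at d f : Prop := lead_at (U_(ord_max) *+ d)%MM f.

Lemma last_lep d m : (U_(ord_max) *+ d <= m)%MM = (d <= m ord_max)%N.
Proof.
apply/mnm_lepP/idP => [/(_ ord_max)|le i]; rewrite mulmnE mnm1E ?eqxx ?mul1n //.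
by case: eqP => [<-|]; rewrite ?mul1n ?mul0n.
Qed.

(** Since the leading monomial of w is xlast^d, the remainder of the division by
    w involves xlast with exponents less than d only. *)
Lemma weierstrass_division d w f : regular_at d w ->
  exists q c, f = q * w + low d c.
Proof.
move=> lw; have [q [r [fE rE]]] := fps_division1 f lw.
pose c i : A := Fps (fun m : 'X_{1..n} => r (mnmwiden m + U_(ord_max) *+ i)%MM).
exists q, c; rewrite fE; congr (_ + _); apply: fpsP => m; rewrite lowE.
case: ltnP => [_|le]; last by rewrite rE ?last_lep.
by rewrite /= mnmnarrowK.
Qed.

Lemma weierstrass_uniq d w q c : regular_at d w ->
  q * w = low d c -> q = 0 /\ forall i, (i < d)%N -> c i = 0.
Proof.
move=> lw e; have q0 : q = 0.
  apply: (fps_division_uniq lw) => m; rewrite last_lep e lowE.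
  by case: ltnP.
by split=> //; apply: low_inj; rewrite -e q0 mul0r.
Qed.

End Widen.

(** * Torsion-free quotients and principal ideals *)

Section Determinants.

(** Multiply the system by its adjugate matrix. *)
Lemma det_mul_in_ideal (R : comNzRingType) (J : ideal R) e (M : 'M[R]_e)
    (v : 'I_e -> R) :
  (forall i, J (\sum_j M i j * v j)) -> forall i, J (\det M * v i).
Proof.
move=> JM i; have -> : \det M * v i = \sum_j \adj M i j * \sum_l M j l * v l.
  under [RHS]eq_bigr => j _ do rewrite mulr_sumr.
  rewrite exchange_big /= (bigD1 i) //= [X in _ = _ + X]big1 ?addr0.
    have := congr1 (fun N : 'M_e => N i i) (mul_adj_mx M).
    rewrite !mxE eqxx mulr1n => <-; rewrite mulr_suml.
    by apply: eq_bigr => j _; rewrite mulrA.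
  move=> l li; have := congr1 (fun N : 'M_e => N i l) (mul_adj_mx M).
  rewrite !mxE eq_sym (negPf li) mulr0n => e0.
  under eq_bigr => j _ do rewrite mulrA.
  by rewrite -mulr_suml e0 mul0r.
by apply: ideal_sum => j _; apply: ideal_mul.
Qed.

Lemma det_sub_horner (A R : comNzRingType) (h : {rmorphism A -> R}) e
    (T : 'M[A]_e) y :
  \det (y%:M - map_mx h T) = (map_poly h (char_poly T)).[y].
Proof.
rewrite map_char_poly -horner_evalE -det_map_mx; congr (\det _).
apply/matrixP => i j; rewrite !mxE /= /horner_eval hornerD hornerN hornerC.
by rewrite hornerMn hornerX.
Qed.

(** Keeping the factor T^i in the statement lets the induction on m proceed one
    factor at a time, without expanding the power. *)
Lemma denominators_sub (R : comNzRingType) e (T : 'M[R]_e.+1) (a x c : R) :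
  (forall i, exists B, c *: T ^+ i = a ^+ i *: B) ->
  forall m i, exists B, c *: (((a * x)%:M - T) ^+ m * T ^+ i) = a ^+ (m + i) *: B.
Proof.
move=> cT; elim=> [|m IH] i; first by rewrite expr0 mul1r; apply: cT.
have [[B BE] [B' BE']] := (IH i, IH i.+1).
exists (x *: B - B'); rewrite exprSr -mulrA mulrBl mulrBr -exprS scalerBr BE'.
have -> : (a * x)%:M * T ^+ i = (a * x) *: T ^+ i by exact: mul_scalar_mx.
rewrite -scalerAr scalerA mulrC -scalerA BE scalerBr !scalerA addnS.
by congr (_ *: _ - _); rewrite addSn exprS; ring.
Qed.

End Determinants.

Section TorsionFree.
Variables (n : nat) (k : fieldType).
Local Notation A := (fps n k).
Local Notation R := (fps n.+1 k).
Local Notation iota := (@fps_widen n k).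
Local Notation x := (xlast n k).
Variables (J : ideal R) (D : nat) (H : R).
Hypotheses (JH : J H) (regH : regular_at D H).
Hypothesis J_order : forall f, J f -> order_ge D f.
Hypothesis J_torsionfree : forall a f, a != 0 -> J (iota a * f) -> J f.

Lemma iota_inj : injective iota.
Proof.
move=> a b /eqP; rewrite -subr_eq0 -rmorphB /= -low1 => /eqP/low_inj/(_ 0%N isT)/eqP.
by rewrite subr_eq0 => /eqP.
Qed.

Lemma iota_eq0 a : (iota a == 0) = (a == 0).
Proof. by rewrite -(rmorph0 iota) (inj_eq iota_inj). Qed.

Section Dependence.
Variables (e : nat) (c : nat -> A).
Hypothesis lt_eD : (e.+1 < D)%N.
Hypothesis indep : forall b, J (low e.+1 b) -> forall i, (i < e.+1)%N -> b i = 0.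
Hypothesis Jc : J (low e.+2 c).
Let a := c e.+1.
Hypothesis a_neq0 : a != 0.

(** Coordinates on the span of 1, x, ..., x^e, which is free modulo J. *)
Let lin (b : 'I_e.+1 -> A) : R := \sum_j iota (b j) * x ^+ j.

Let lin_low b : lin b = low e.+1 (fun j => b (inord j)).
Proof. by apply: eq_bigr => j _; rewrite inord_val. Qed.

Let lin_inj b : J (lin b) -> forall i, b i = 0.
Proof. by rewrite lin_low => /indep ib i; rewrite -(ib i) ?inord_val. Qed.

Let linD b b' : lin b + lin b' = lin (fun i => b i + b' i).
Proof. by rewrite -big_split; apply: eq_bigr => i _; rewrite rmorphD mulrDl. Qed.

Let linM u b : iota u * lin b = lin (fun i => u * b i).
Proof. by rewrite mulr_sumr; apply: eq_bigr => i _; rewrite rmorphM mulrA. Qed.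

(** The relation c of degree e+1 has leading coefficient a, so each factor x
    costs one factor a in the denominator of y with respect to that span. *)
Let spanned N (y : R) := exists b, J (iota a ^+ N * y - lin b).

Let spannedJ N y : J y -> spanned N y.
Proof.
move=> Jy; exists (fun=> 0); apply: ideal_sub; first exact: ideal_mul.
by apply: ideal_sum => i _; rewrite rmorph0 mul0r; apply: ideal_zero.
Qed.

Let spannedD N y z : spanned N y -> spanned N z -> spanned N (y + z).
Proof.
move=> [b Jb] [b' Jb']; exists (fun i => b i + b' i).
by rewrite -linD mulrDr opprD addrACA; apply: ideal_add.
Qed.

Let spannedZ N u y : spanned N y -> spanned N (iota u * y).
Proof.
move=> [b Jb]; exists (fun i => u * b i).
by rewrite -linM mulrCA -mulrBr; apply: ideal_mul.
Qed.

Let spanned_sum N m (F : 'I_m -> R) :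
  (forall i, spanned N (F i)) -> spanned N (\sum_i F i).
Proof.
move=> SF; elim/big_ind: _ => //; last exact: spannedD.
by apply: spannedJ; apply: ideal_zero.
Qed.

Let spanned_add N M y : spanned N y -> spanned (M + N) y.
Proof.
move=> [b Jb]; exists (fun i => a ^+ M * b i).
by rewrite -linM rmorphXn exprD -mulrA -mulrBr; apply: ideal_mul.
Qed.

Let spanned_trans N (y z : R) : J (iota a ^+ N * y - z) -> spanned 0 z -> spanned N y.
Proof.
move=> Jyz [b Jb]; exists b; rewrite -(subrK z (_ * y)) -addrA.
by apply: ideal_add => //; rewrite -[z]mul1r -(expr0 (iota a)).
Qed.

Let spanned0 (i : 'I_e.+1) : spanned 0 (x ^+ i).
Proof.
exists (fun j => (j == i)%:R); rewrite mul1r /lin (bigD1 i) //= eqxx rmorph1 mul1r.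
rewrite big1 ?addr0 ?subrr => [|j /negPf ->]; first exact: ideal_zero.
by rewrite rmorph0 mul0r.
Qed.

Let spannedX N y : spanned N y -> spanned N.+1 (x * y).
Proof.
move=> [b Jb]; apply: (@spanned_trans _ _ (iota a * (x * lin b))).
  have -> : iota a ^+ N.+1 * (x * y) - iota a * (x * lin b) =
            iota a * x * (iota a ^+ N * y - lin b) by rewrite exprS; ring.
  exact: ideal_mul.
rewrite !mulr_sumr; apply: spanned_sum => i.
have -> : iota a * (x * (iota (b i) * x ^+ i)) = iota (b i) * (iota a * x ^+ i.+1).
  by rewrite exprS; ring.
apply: spannedZ; have [lt|ge] := ltnP i.+1 e.+1.
  by apply: spannedZ; exact: (spanned0 (Ordinal lt)).
have -> : i.+1 = e.+1 by have := ltn_ord i; lia.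
move: Jc; rewrite /low big_ord_recr /= -/a => Jc'.
exists (fun i => - c i); rewrite mul1r.
suff -> : lin (fun i => - c i) = - \sum_(i < e.+1) iota (c i) * x ^+ i.
  by rewrite opprK addrC.
by rewrite -sumrN; apply: eq_bigr => j _; rewrite rmorphN mulNr.
Qed.

Let spannedXn i : spanned i (x ^+ i).
Proof.
elim: i => [|i IH]; first exact: (spanned0 ord0).
by rewrite exprS; apply: spannedX.
Qed.

Let spanned_all y : spanned D y.
Proof.
have [q [b ->]] := weierstrass_division y regH.
apply: spannedD; first by apply: spannedJ; apply: ideal_mul.
apply: spanned_sum => i; apply: spannedZ.
by have := spanned_add (D - i) (spannedXn i); rewrite subnK // ltnW.
Qed.

(** T is the matrix of multiplication by a x on the module. Since a^D takes
    everything into the module, the powers of T have bounded denominators with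
    respect to those of a; so do the powers of a x - T, hence a^(e+1) divides
    det (a x - T), because R is completely integrally closed. The quotient
    lies in J, but it is monic of degree e+1 < D in x. *)
Lemma no_dependence : False.
Proof.
have /choice[t tJ] : forall i : 'I_e.+1, exists b, J (iota a * (x * x ^+ i) - lin b).
  by move=> i; have := spannedX (spanned0 i); rewrite /spanned expr1.
pose T : 'M[A]_e.+1 := \matrix_(i, j) t i j.
have TJ (i : 'I_e.+1) : J (iota a * (x * x ^+ i) - \sum_j iota (T i j) * x ^+ j).
  by under eq_bigr => j _ do rewrite mxE; apply: tJ.
have powT m (i : 'I_e.+1) :
    J ((iota a * x) ^+ m * x ^+ i - lin (fun j => (T ^+ m) i j)).
  elim: m i => [|m IH] i.
    rewrite expr0 mul1r /lin (bigD1 i) //= expr0 mxE eqxx rmorph1 mul1r big1.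
      by rewrite addr0 subrr; apply: ideal_zero.
    by move=> j /negPf ne; rewrite mxE eq_sym ne rmorph0 mul0r.
  pose u := \sum_j iota (T i j) * x ^+ j.
  have -> : (iota a * x) ^+ m.+1 * x ^+ i - lin (fun j => (T ^+ m.+1) i j) =
      (iota a * x) ^+ m * (iota a * (x * x ^+ i) - u) +
      \sum_l iota (T i l) * ((iota a * x) ^+ m * x ^+ l - lin (fun j => (T ^+ m) l j)).
    have -> : lin (fun j => (T ^+ m.+1) i j) =
        \sum_l iota (T i l) * lin (fun j => (T ^+ m) l j).
      under [RHS]eq_bigr => l _ do rewrite mulr_sumr.
      rewrite exchange_big; apply: eq_bigr => j _ /=.
      rewrite exprS mxE rmorph_sum mulr_suml; apply: eq_bigr => l _.
      by rewrite rmorphM mulrA.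
    under [X in _ = _ + X]eq_bigr => l _ do rewrite mulrBr.
    rewrite sumrB addrA; congr (_ - _).
    rewrite mulrBr /u [X in _ - X]mulr_sumr.
    under [X in _ = _ + X]eq_bigr => l _ do rewrite mulrCA.
    by rewrite subrK exprSr !mulrA.
  apply: ideal_add; first by apply: ideal_mul.
  by apply: ideal_sum => l _; apply: ideal_mul.
have denomT m : exists B : 'M[A]_e.+1, a ^+ D *: T ^+ m = a ^+ m *: B.
  have /choice[b bJ] : forall i : 'I_e.+1, exists b,
      J (iota a ^+ D * (x ^+ m * x ^+ i) - lin b) by move=> i; apply: spanned_all.
  exists (\matrix_(i, j) b i j); apply/matrixP => i j; rewrite !mxE.
  apply/eqP; rewrite -subr_eq0; apply/eqP.
  apply: (@lin_inj (fun j => a ^+ D * (T ^+ m) i j - a ^+ m * b i j)).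
  have := ideal_sub (ideal_mul (iota a ^+ m) (bJ i))
                    (ideal_mul (iota a ^+ D) (powT m i)).
  set z := (X in J X -> _); suff -> : z = lin (fun j =>
      a ^+ D * (T ^+ m) i j - a ^+ m * b i j) by [].
  have -> : lin (fun j => a ^+ D * (T ^+ m) i j - a ^+ m * b i j) =
      iota (a ^+ D) * lin (fun j => (T ^+ m) i j) - iota (a ^+ m) * lin (b i).
    rewrite !linM -sumrB; apply: eq_bigr => l _.
    by rewrite rmorphB mulrBl.
  by rewrite /z !rmorphXn exprMn; ring.
pose X : 'M[R]_e.+1 := (iota a * x)%:M - map_mx iota T.
have denomX m : exists B : 'M[R]_e.+1, iota a ^+ D *: X ^+ m = iota a ^+ m *: B.
  have [|B BE] := @denominators_sub _ _ (map_mx iota T) (iota a) x (iota a ^+ D) _ m 0.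
    move=> i; have [B BE] := denomT i; exists (map_mx iota B).
    by rewrite -!rmorphXn -!map_mxZ BE.
  by exists B; move: BE; rewrite expr0 mulr1 addn0.
have denom_det m : exists r, (iota a ^+ D) ^+ e.+1 * (\det X) ^+ m =
    (iota a ^+ e.+1) ^+ m * r.
  have [B BE] := denomX m; exists (\det B); have := congr1 determinant BE.
  rewrite !detZ -!exprM [(m * _)%N]mulnC => <-; congr (_ * _).
  elim: (m) => [|l IHl]; first by rewrite !expr0 det1.
  by rewrite !exprS det_mulmx IHl.
have na : iota a != 0 by rewrite iota_eq0.
have [h hE] := fps_completely_integrally_closed
  (expf_neq0 e.+1 na) (expf_neq0 e.+1 (expf_neq0 D na)) denom_det.
have JX : J (\det X).
  have := @det_mul_in_ideal _ J _ X (fun j => x ^+ j) _ ord0.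
  rewrite mulr1; apply=> i.
  suff -> : \sum_j X i j * x ^+ j =
    iota a * (x * x ^+ i) - \sum_j iota (T i j) * x ^+ j by [].
  rewrite mulrA; under eq_bigr => j _ do rewrite !mxE mulrBl.
  rewrite sumrB; congr (_ - _); last by apply: eq_bigr => j _; rewrite mxE.
  rewrite (bigD1 i) //= eqxx mulr1n big1 ?addr0 // => j /negPf ne.
  by rewrite eq_sym ne mulr0n mul0r.
have Jh : J h.
  apply: (@J_torsionfree (a ^+ e.+1)); first exact: expf_neq0.
  by rewrite rmorphXn mulrC -hE; exact: JX.
pose chi := char_poly T.
have XE : \det X = low e.+2 (fun i => chi`_i * a ^+ i).
  rewrite det_sub_horner (horner_coef_wide (n := e.+2)); last first.
    by rewrite (leq_trans (size_poly _ _)) // size_char_poly.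
  by apply: eq_bigr => i _; rewrite coef_map rmorphM rmorphXn exprMn mulrA.
have chi1 : chi`_e.+1 = 1.
  by have /monicP := char_poly_monic T; rewrite lead_coefE size_char_poly.
have reg_x : regular_at e.+2 (x ^+ e.+2).
  by rewrite fpsXn; apply: lead_atX.
have [q [b hE']] := weierstrass_division h reg_x.
have : iota (a ^+ e.+1) * q * x ^+ e.+2 =
       low e.+2 (fun i => chi`_i * a ^+ i - a ^+ e.+1 * b i).
  have <- : low e.+2 (fun i => chi`_i * a ^+ i) - iota (a ^+ e.+1) * low e.+2 b =
      low e.+2 (fun i => chi`_i * a ^+ i - a ^+ e.+1 * b i).
    by rewrite lowM /low -sumrB; apply: eq_bigr => i _; rewrite rmorphB mulrBl.
  by rewrite -XE hE hE' rmorphXn; ring.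
case/(weierstrass_uniq reg_x) => /eqP + /(_ e.+1 (ltnSn _)).
rewrite mulf_eq0 iota_eq0 expf_eq0 (negPf a_neq0) andbF /= => /eqP q0.
have -> : chi`_e.+1 * a ^+ e.+1 - a ^+ e.+1 * b e.+1 = a ^+ e.+1 * (1 - b e.+1).
  by rewrite chi1 mul1r mulrBr mulr1.
move=> /eqP; rewrite mulf_eq0 expf_eq0 (negPf a_neq0) andbF /= subr_eq0 => /eqP b1.
have := J_order Jh; rewrite hE' q0 mul0r add0r.
move=> /(_ (mnmwiden 0 + U_(ord_max) *+ e.+1)%MM); rewrite lowE mnmwiden_last ltnSn.
rewrite mnmwidenK -b1 fps1E eqxx mdegD mdegMn mdeg1 mul1n mdeg_mnmwiden mdeg0.
by move=> /(_ lt_eD)/eqP; rewrite oner_eq0.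
Qed.

End Dependence.

(** A shortest relation would contradict [no_dependence]; a relation of length
    one puts a nonzero constant, hence 1, into J, which J_order excludes. *)
Lemma low_independent e c : (e <= D)%N -> J (low e c) ->
  forall i, (i < e)%N -> c i = 0.
Proof.
elim: e c => // e IH c lt_eD Jc.
have ce0 : c e = 0.
  apply: contrapT => /eqP nz; case: e => [|e] in IH c lt_eD Jc nz *.
    have J1 : J 1.
      apply: (J_torsionfree nz); rewrite mulr1 -low1.
      by rewrite (eq_low (c' := c)) // => -[].
    have := J_order J1 (m := 0%MM); rewrite fps1E eqxx mdeg0 => /(_ lt_eD)/eqP.
    by rewrite oner_eq0.
  apply: (@no_dependence e c) => // b Jb; apply: IH => //; exact: ltnW.
move: Jc; rewrite /low big_ord_recr /= ce0 rmorph0 mul0r addr0 => Jc i.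
rewrite ltnS leq_eqVlt => /predU1P[-> //|]; apply: IH => //; exact: ltnW.
Qed.

(** Modulo H, an element of J is a combination of 1, x, ..., x^(D-1), which are
    independent modulo J. *)
Lemma torsionfree_principal f : J f -> exists q, f = q * H.
Proof.
move=> Jf; have [q [c fE]] := weierstrass_division f regH.
exists q; rewrite fE; suff c0 i : (i < D)%N -> c i = 0.
  by rewrite (eq_low c0) low0 addr0.
apply: (low_independent (leqnn D)); apply: (@ideal_addl _ _ (q * H)).
  exact: ideal_mul.
by rewrite -fE.
Qed.

End TorsionFree.

(** * Linear changes of coordinates *)

Lemma natr_inj (k : fieldType) : [pchar k] =i pred0 ->
  injective (fun i => i%:R : k).
Proof.
move=> char0 i j /eqP; wlog le_ij : i j / (i <= j)%N.
  by move=> W; case/orP: (leq_total i j) => /W // + /eqP/esym/eqP => /[apply].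
rewrite eq_sym -subr_eq0 -natrB // ((pcharf0P k).1 char0) subn_eq0 => le_ji.
by apply/eqP; rewrite eqn_leq le_ij.
Qed.

Section NonVanishing.
Variable k : fieldType.
Hypothesis char0 : [pchar k] =i pred0.

Lemma poly_nonroot (p : {poly k}) : p != 0 -> exists t, p.[t] != 0.
Proof.
move=> nz; apply: contrapT => no.
pose rs := [seq i%:R : k | i <- iota 0 (size p)].
suff /(max_poly_roots nz) : all (root p) rs.
  rewrite size_map size_iota ltnn => H; suff /H : uniq rs by [].
  by rewrite (map_inj_uniq (natr_inj char0)) iota_uniq.
by apply/allP => t _; apply/eqP; apply: contrapT => /eqP pt; apply: no; exists t.
Qed.

(** Induction on the number of variables, by specializing all but the last one at
    a point where some coefficient does not vanish. *)
Lemma mpoly_nonzero_point n (p : {mpoly k[n]}) : p != 0 -> exists v, p.@[v] != 0.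
Proof.
elim: n p => [|n IH] p nz.
  exists (fun=> 0); rewrite [p]nvar0_mpolyC mevalC.
  by apply: contraNneq nz => e; rewrite [p]nvar0_mpolyC e mpolyC0.
have [m0 pm0] : exists m, p@_m != 0.
  by exists (mlead p); rewrite mleadc_eq0.
pose j := m0 ord_max.
pose pj : {mpoly k[n]} := \sum_(m <- msupp p | m ord_max == j) p@_m *: 'X_[mnmnarrow m].
have [|v pv] := IH pj.
  suff e : pj@_(mnmnarrow m0) = p@_m0 by apply: contraNneq pm0 => z; rewrite -e z mcoeff0.
  rewrite raddf_sum big_mkcond (bigD1_seq m0) ?msupp_uniq ?mcoeff_msupp //=.
  rewrite eqxx mcoeffZ mcoeffX eqxx mulr1 big1 ?addr0 // => m ne.
  case: ifP => // /eqP mj; rewrite mcoeffZ mcoeffX; case: eqP => [e|_]; last by rewrite mulr0.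
  by case/eqP: ne; rewrite -[m]mnmnarrowK e mj mnmnarrowK.
pose P : {poly k} := \sum_(m <- msupp p)
  (p@_m * \prod_i v i ^+ mnmnarrow m i) *: 'X^(m ord_max).
have [|t Pt] := @poly_nonroot P.
  suff e : P`_j = pj.@[v] by apply: contraNneq pv => z; rewrite -e z coef0.
  rewrite coef_sum raddf_sum big_mkcond [RHS]big_mkcond; apply: eq_bigr => m _.
  rewrite coefZ coefXn eq_sym; case: ifP => _; last by rewrite mulr0.
  by rewrite mulr1 /= mevalZ mevalX.
pose w (i : 'I_n.+1) := if unlift ord_max i is Some i' then v i' else t.
exists w; suff -> : p.@[w] = P.[t] by [].
rewrite mevalE horner_sum; apply: eq_bigr => m _.
rewrite hornerZ hornerXn -mulrA big_ord_recr /=; congr (_ * (_ * _)).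
  apply: eq_bigr => i _; rewrite mnmE /w.
  have -> : widen_ord (leqnSn n) i = lift ord_max i.
    by apply: val_inj; rewrite /= /bump leqNgt ltn_ord.
  by rewrite liftK.
by rewrite /w unlift_none.
Qed.

End NonVanishing.

Section Substitution.
Variables (n : nat) (k : fieldType) (l : n.-tuple {mpoly k[n]}).
Hypothesis l_linear : forall i, tnth l i \is 1.-homog.
Implicit Types (f g : fps n k) (p q : {mpoly k[n]}) (d : nat) (m : 'X_{1..n}).

Lemma comp_monomial_homog m : 'X_[m] \mPo l \is (mdeg m).-homog.
Proof.
rewrite comp_mpolyX mdegE.
elim/big_rec2: _ => [|i q d _ IH]; first exact: dhomog1.
apply: dhomogM => //; rewrite -[X in X.-homog]mul1n; exact: dhomogMn.
Qed.

(** A linear substitution does not mix degrees, hence is continuous and extends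
    to power series. *)
Lemma comp_order d p : (forall m, (mdeg m < d)%N -> p@_m = 0) ->
  forall m, (mdeg m < d)%N -> (p \mPo l)@_m = 0.
Proof.
move=> p0 m lt; rewrite comp_mpolyEX raddf_sum big1_seq // => m' /andP[_ m'p].
rewrite /= mcoeffZ (dhomog_nemf_coeff (comp_monomial_homog m')) ?mulr0 //.
apply: contraTneq m'p => e; rewrite mcoeff_msupp p0 ?eqxx //; by rewrite e in lt.
Qed.

Definition fps_subst f : fps n k :=
  Fps (fun m => (truncate (mdeg m).+1 f \mPo l)@_m).

Lemma agree_subst d f p : agree d f p -> agree d (fps_subst f) (p \mPo l).
Proof.
move=> fp m lt /=; apply/eqP; rewrite -subr_eq0 -mcoeffB -comp_mpolyB.
apply/eqP; apply: (comp_order (d := (mdeg m).+1)) => // m' lt'.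
rewrite mcoeffB -agree_truncate // fp ?subrr //.
exact: leq_trans lt' lt.
Qed.

Lemma order_ge_subst d f : order_ge d f -> order_ge d (fps_subst f).
Proof.
move=> df m lt; rewrite (@agree_subst d f 0) ?comp_mpoly0 ?mcoeff0 //.
by move=> m' lt'; rewrite mcoeff0 df.
Qed.

Fact fps_subst_is_zmod_morphism : zmod_morphism fps_subst.
Proof.
move=> f g; apply: fpsP => m; rewrite fpsBE.
have [Af Ag] := (@agree_truncate _ _ (mdeg m).+1 f, @agree_truncate _ _ (mdeg m).+1 g).
rewrite (agree_subst (agreeB Af Ag)) // comp_mpolyB mcoeffB.
by rewrite (agree_subst Af) // (agree_subst Ag).
Qed.

Fact fps_subst_is_monoid_morphism : monoid_morphism fps_subst.
Proof.
split=> [|f g]; apply: fpsP => m.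
  rewrite (@agree_subst (mdeg m).+1 1 1) ?comp_mpoly1 ?mcoeff1 //.
  by move=> m' _; rewrite mcoeff1.
have [Af Ag] := (@agree_truncate _ _ (mdeg m).+1 f, @agree_truncate _ _ (mdeg m).+1 g).
rewrite (agree_subst (agreeM Af Ag)) // rmorphM.
by rewrite (agreeM (agree_subst Af) (agree_subst Ag)).
Qed.

(** The linearity hypothesis is an argument, so that the ring morphism structure
    can be inferred from the term. *)
Definition linear_subst of (forall i, tnth l i \is 1.-homog) := fps_subst.

HB.instance Definition _ := GRing.isZmodMorphism.Build (fps n k) (fps n k)
  (linear_subst l_linear) fps_subst_is_zmod_morphism.
HB.instance Definition _ := GRing.isMonoidMorphism.Build (fps n k) (fps n k)
  (linear_subst l_linear) fps_subst_is_monoid_morphism.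

(** Both sides are derivations along the substitution, and agree on variables. *)
Lemma mderiv_comp j p :
  (p \mPo l)^`M(j) = \sum_i (tnth l i)^`M(j) * (p^`M(i) \mPo l).
Proof.
pose P p := (p \mPo l)^`M(j) = \sum_i (tnth l i)^`M(j) * (p^`M(i) \mPo l).
have PM q r : P q -> P r -> P (q * r).
  rewrite /P rmorphM mderivM => -> ->.
  rewrite mulr_suml mulr_sumr -big_split; apply: eq_bigr => i _ /=.
  by rewrite mderivM comp_mpolyD !rmorphM /=; ring.
have P1 : P 1.
  rewrite /P comp_mpoly1 -mpolyC1 mderivC big1 // => i _.
  by rewrite mderivC comp_mpoly0 mulr0.
have PX i : P 'X_i.
  rewrite /P comp_mpolyXU (bigD1 i) //= mderivX mnm1E eqxx scale1r.
  rewrite -[X in 'X_[X - _]]add0m addmK mpolyX0 comp_mpoly1 mulr1 big1 ?addr0 ?(tnth_nth 0) // => i' ne.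
  by rewrite mderivX mnm1E eq_sym (negPf ne) scale0r comp_mpoly0 mulr0.
elim/mpolyind: p => [|c m p _ _ IH].
  rewrite comp_mpoly0 mderiv0 big1 // => i _.
  by rewrite mderiv0 comp_mpoly0 mulr0.
have Pm : P 'X_[m].
  rewrite mpolyXE_id; elim/big_ind: _ => // i _.
  by elim: (m i) => [|e IHe]; rewrite ?expr0 // exprS; apply: PM.
rewrite comp_mpolyD mderivD IH comp_mpolyZ mderivZ Pm scaler_sumr -big_split.
apply: eq_bigr => i _ /=.
by rewrite mderivD mderivZ comp_mpolyD comp_mpolyZ mulrDr scalerAr.
Qed.

End Substitution.

Section SubstitutionDeriv.
Variables (n : nat) (k : fieldType).

Lemma agree_deriv d (f : fps n k) p i :
  agree d.+1 f p -> agree d (fps_deriv i f) p^`M(i).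
Proof.
by move=> fp m lt; rewrite mcoeff_deriv /= fp // mdegD mdeg1 addn1.
Qed.

Lemma fps_deriv_subst (l : n.-tuple {mpoly k[n]})
    (l_linear : forall i, tnth l i \is 1.-homog) j :
  exists c : 'I_n -> fps n k, forall f,
    fps_deriv j (linear_subst l_linear f) =
    \sum_i c i * linear_subst l_linear (fps_deriv i f).
Proof.
exists (fun i => Fps (fun m => ((tnth l i)^`M(j))@_m)) => f; apply: fpsP => m.
have Af := @agree_truncate _ _ (mdeg m).+2 f.
rewrite (agree_deriv j (agree_subst l_linear Af)) // mderiv_comp raddf_sum fps_sumE.
apply: eq_bigr => i _.
have Ai : agree (mdeg m).+1 (Fps (fun m => ((tnth l i)^`M(j))@_m)) (tnth l i)^`M(j).
  by [].
by rewrite (agreeM Ai (agree_subst l_linear (agree_deriv i Af))).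
Qed.

Lemma linear_substK (l l' : n.-tuple {mpoly k[n]})
    (hl : forall i, tnth l i \is 1.-homog) (hl' : forall i, tnth l' i \is 1.-homog) :
  (forall i, tnth l i \mPo l' = 'X_i) ->
  cancel (linear_subst hl) (linear_subst hl').
Proof.
move=> ll' f; apply: fpsP => m.
have Af := @agree_truncate _ _ (mdeg m).+1 f.
rewrite (agree_subst hl' (agree_subst hl Af)) // [RHS]Af //; congr (_@_m).
move: (truncate _ _) => p; rewrite [p \mPo l]comp_mpolyE raddf_sum [RHS]mpolyE.
apply: eq_bigr => m' _ /=; rewrite comp_mpolyZ rmorph_prod /= mpolyXE_id.
by congr (_ *: _); apply: eq_bigr => i _; rewrite rmorphXn /= ll'.
Qed.

End SubstitutionDeriv.

Section CoordinateChange.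
Variables (n : nat) (k : fieldType).
Hypothesis char0 : [pchar k] =i pred0.
Local Notation R := (fps n.+1 k).
Implicit Types (c : 'I_n.+1 -> k) (f g : R).

Definition shear c : n.+1.-tuple {mpoly k[n.+1]} :=
  [tuple (if i == ord_max then 0 else 'X_i) + c i *: 'X_ord_max | i < n.+1].

Lemma shear_linear c i : tnth (shear c) i \is 1.-homog.
Proof.
have hX j : 'X_j \is [in k[n.+1], 1.-homog] by rewrite dhomogX /= mdeg1.
by rewrite tnth_mktuple rpredD ?rpredZ //; case: ifP => _; rewrite ?rpred0.
Qed.

Lemma shearK c c' : c ord_max * c' ord_max = 1 ->
  (forall i, i != ord_max -> c' i + c i * c' ord_max = 0) ->
  forall i, tnth (shear c) i \mPo shear c' = 'X_i.
Proof.
move=> c1 c0 i; rewrite tnth_mktuple comp_mpolyD comp_mpolyZ !comp_mpolyXU.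
rewrite -tnth_nth tnth_mktuple eqxx add0r scalerA.
case: eqP => [->|/eqP ne]; first by rewrite comp_mpoly0 add0r c1 scale1r.
rewrite comp_mpolyXU -tnth_nth tnth_mktuple (negPf ne) -addrA -scalerDl c0 //.
by rewrite scale0r addr0.
Qed.

Lemma shear_inverse c : c ord_max != 0 -> exists c',
  [/\ forall i, tnth (shear c) i \mPo shear c' = 'X_i
    & forall i, tnth (shear c') i \mPo shear c = 'X_i].
Proof.
move=> nz; exists (fun i => if i == ord_max then (c ord_max)^-1 else - c i / c ord_max).
split; apply: shearK => [|i ne]; rewrite ?eqxx ?(negPf ne) ?mulfV ?mulVf //.
  by rewrite mulNr addNr.
by rewrite mulfVK ?subrr.
Qed.

Definition initial_form d f : {mpoly k[n.+1]} :=
  \sum_(m : 'X_{1..n.+1 < d.+1} | mdeg m == d) f m *: 'X_[m].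

Lemma initial_form_homog d f : initial_form d f \is d.-homog.
Proof.
by apply: rpred_sum => m /eqP md; apply: rpredZ; rewrite dhomogX /= md.
Qed.

Lemma initial_formE d f m : mdeg m = d -> (initial_form d f)@_m = f m.
Proof.
move=> md; have lt : (mdeg m < d.+1)%N by rewrite md.
rewrite raddf_sum (bigD1 (BMultinom lt)) /= ?md // mcoeffZ mcoeffX eqxx mulr1.
rewrite big1 ?addr0 // => m' /andP[_ ne]; rewrite mcoeffZ mcoeffX.
by case: eqP => [e|_]; [case/eqP: ne; apply: val_inj | rewrite mulr0].
Qed.

Lemma agree_initial_form d f : order_ge d f -> agree d.+1 f (initial_form d f).
Proof.
move=> df m; rewrite ltnS leq_eqVlt => /predU1P[/initial_formE-> //|lt].
rewrite df // (dhomog_nemf_coeff (initial_form_homog d f)) //.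
by rewrite neq_ltn lt.
Qed.

(** The last variable is the least one, so its d-th power is the least monomial
    of degree d. *)
Lemma mdeg_lt_last d (m : 'X_{1..n.+1}) : (m < (U_(ord_max) *+ d)%MM)%O -> (mdeg m < d)%N.
Proof.
have degU : mdeg (U_(ord_max : 'I_n.+1) *+ d)%MM = d by rewrite mdegMn mdeg1 mul1n.
move=> lt; have := lemc_mdeg (ltW lt); rewrite degU leq_eqVlt => /predU1P[e|//].
case/ltmcP: lt => [|i]; first by rewrite degU.
have [->|[j ->]] := ord_lastP i => low_i; last by rewrite mulmnE mnm1E -val_eqE /= gtn_eqF.
rewrite mulmnE mnm1E eqxx mul1n; suff <- : mdeg m = m ord_max by [].
rewrite mdegE (bigD1 ord_max) //= big1 ?addn0 // => j jl.
rewrite low_i ?mulmnE ?mnm1E 1?eq_sym ?(negPf jl) //.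
case: (ord_lastP j) jl => [->|[j' ->] _]; first by rewrite eqxx.
exact: (ltn_ord j').
Qed.

(** At (0, ..., 0, 1) only the power of the last variable survives. *)
Lemma homog_meval_last d (q : {mpoly k[n.+1]}) : q \is d.-homog ->
  q.@[fun i => (i == ord_max)%:R] = q@_(U_(ord_max) *+ d)%MM.
Proof.
move=> hq; rewrite mevalE; set u := (U_(ord_max) *+ d)%MM.
have u1 : \prod_i (i == ord_max :> 'I_n.+1)%:R ^+ u i = 1 :> k.
  apply: big1 => i _; rewrite mulmnE mnm1E.
  by case: (eqVneq i ord_max) => _; rewrite ?expr1n // mul0n.
have other m : m \in msupp q -> m != u ->
    \prod_i (i == ord_max :> 'I_n.+1)%:R ^+ m i = 0 :> k.
  move=> mq /eqP ne; have md : mdeg m = d by exact: (dhomog_mf hq).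
  have [i /andP[il mi]] : exists i, (i != ord_max) && (m i != 0%N).
    apply/existsP; apply: contrapT => /negP/existsPn no; apply: ne.
    have m0 i : i != ord_max -> m i = 0%N.
      by move=> il; apply/eqP; have := no i; rewrite il /= negbK.
    apply/mnmP => i; rewrite mulmnE mnm1E; case: eqP => [<-|/eqP il].
      by rewrite mul1n -md mdegE (bigD1 ord_max) //= big1 ?addn0.
    by rewrite m0 // eq_sym.
  by rewrite (bigD1 i) //= (negPf il) expr0n (negPf mi) mul0r.
have [uq|nuq] := boolP (u \in msupp q).
  rewrite (bigD1_seq u) ?msupp_uniq //= u1 mulr1 big1_seq ?addr0 // => m /andP[ne mq].
  by rewrite other ?mulr0.
rewrite (memN_msupp_eq0 nuq) big1_seq // => m /andP[_ mq].
by rewrite other ?mulr0 //; apply: contraNneq nuq => <-.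
Qed.

(** After the shear, the coefficient of x_last^d is the value at c of the initial
    form of f. *)
Lemma shear_regular c d f : order_ge d f -> (initial_form d f).@[c] != 0 ->
  regular_at d (linear_subst (@shear_linear c) f).
Proof.
move=> df pc; split; last first.
  move=> m /mdeg_lt_last; apply: order_ge_subst => //; exact: shear_linear.
have degU : mdeg (U_(ord_max : 'I_n.+1) *+ d)%MM = d by rewrite mdegMn mdeg1 mul1n.
rewrite (agree_subst (@shear_linear c) (agree_initial_form df)) ?degU //.
rewrite -homog_meval_last; last first.
  rewrite comp_mpolyEX big_seq; apply: rpred_sum => m mp; apply: rpredZ.
  rewrite -(dhomog_mf (initial_form_homog d f) mp).
  exact: (comp_monomial_homog (@shear_linear c)).
rewrite comp_mpoly_meval (meval_eq (v2 := c)) // => i.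
rewrite tnth_mktuple mevalD mevalZ mevalXU eqxx mulr1.
by case: ifP => [_|il]; rewrite ?meval0 ?mevalXU ?il add0r.
Qed.

(** The field is infinite, so the initial form of f does not vanish at some c with
    c_last nonzero, and the shear along c is invertible. The formula for the
    derivative keeps it within the Jacobian ideal of the original f. *)
Lemma coordinate_change f : f != 0 ->
  exists (phi psi : {rmorphism R -> R}) (d : nat) (a : 'I_n.+1 -> R),
  [/\ cancel phi psi, cancel psi phi, regular_at d (phi f) & order_ge d f]
  /\ (forall e g, order_ge e g -> order_ge e (phi g))
  /\ (forall g, fps_deriv ord_max (phi g) = \sum_i a i * phi (fps_deriv i g)).
Proof.
move=> /lead_at_exists[m0 lf]; pose d := mdeg m0.
pose p := initial_form d f.
have pm0 : p@_m0 != 0 by rewrite initial_formE //; case: lf.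
have [|c] := @mpoly_nonzero_point k char0 _ (p * 'X_ord_max).
  apply: contraNneq pm0 => /(congr1 (mcoeff (U_(ord_max) + m0)%MM)).
  by rewrite mcoeffMX mcoeff0 => ->.
rewrite mevalM mevalXU mulf_eq0 negb_or => /andP[pc c_last].
have [c' [cc' c'c]] := shear_inverse c_last.
have [a aE] := fps_deriv_subst (@shear_linear c) ord_max.
exists (linear_subst (@shear_linear c)), (linear_subst (@shear_linear c')), d, a.
split; first split.
- exact: linear_substK.
- exact: linear_substK.
- by apply: shear_regular => //; apply: lead_order_ge.
- exact: lead_order_ge.
by split=> // e g; apply: order_ge_subst; apply: shear_linear.
Qed.

End CoordinateChange.

(** * Dimension *)

Section Integrality.
Variables (n : nat) (k : fieldType).
Local Notation A := (fps n k).
Local Notation R := (fps n.+1 k).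
Local Notation iota := (@fps_widen n k).
Local Notation x := (xlast n k).
Variables (d : nat) (w : R).
Hypothesis regw : regular_at d w.
Implicit Types (P Q : ideal R).

(** Modulo w, multiplication by y is an endomorphism of the module spanned over
    A by 1, x, ..., x^(d-1), so that y is a root of its characteristic
    polynomial. *)
Lemma integral_mod_regular P y : P w ->
  exists p : {poly A}, p \is monic /\ P (map_poly iota p).[y].
Proof.
move=> Pw; have [d0|d_gt0] := posnP d.
  exists 1; rewrite monic1 rmorph1 hornerC; split=> //.
  move: regw; rewrite d0 => reg0; have [q [c ->]] := weierstrass_division 1 reg0.
  by rewrite /low big_ord0 addr0; apply: ideal_mul.
have /choice[c cP] : forall i : 'I_d, exists c, P (y * x ^+ i - low d c).
  move=> i; have [q [c ->]] := weierstrass_division (y * x ^+ i) regw.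
  by exists c; rewrite addrK; apply: ideal_mul.
pose T : 'M[A]_d := \matrix_(i, j) c i j.
exists (char_poly T); split; first exact: char_poly_monic.
rewrite -det_sub_horner.
have := @det_mul_in_ideal _ P _ (y%:M - map_mx iota T) (fun j => x ^+ j) _ (Ordinal d_gt0).
rewrite mulr1; apply=> i.
suff -> : \sum_j (y%:M - map_mx iota T) i j * x ^+ j = y * x ^+ i - low d (c i) by [].
under eq_bigr => j _ do rewrite !mxE mulrBl.
rewrite sumrB; congr (_ - _).
rewrite (bigD1 i) //= eqxx mulr1n big1 ?addr0 // => j /negPf ne.
by rewrite eq_sym ne mulr0n mul0r.
Qed.

(** An element y of Q is a root modulo P of a
    monic polynomial over A; its constant term lies in Q, hence in P, so that y
    can be factored out as long as y is not in P. *)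
Lemma contraction_strict P Q : P w -> prime_ideal P -> P `<=` Q ->
  preim_ideal iota Q `<=` preim_ideal iota P -> Q `<=` P.
Proof.
move=> Pw [nP1 primeP] PQ QP y Qy; apply: contrapT => nPy.
have [p [mp Pp]] := integral_mod_regular y Pw.
move: {2}(size p) (leqnn (size p)) => s; elim: s => [|s IH] in p mp Pp *.
  by rewrite leqn0 size_poly_eq0 (negPf (monic_neq0 mp)).
move=> sp; have [p1 [c pE]] : exists p1 c, p = p1 * 'X + c%:P.
  elim/poly_ind: (p) => [|p1 c _]; last by exists p1, c.
  by exists 0, 0; rewrite mul0r add0r.
have [p10|p1n0] := eqVneq p1 0.
  move: mp Pp; rewrite pE p10 mul0r add0r monicE lead_coefC => /eqP ->.
  by rewrite map_polyC hornerC /= rmorph1.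
move: mp Pp sp; rewrite pE size_MXaddC (negPf p1n0) /= ltnS => mp Pp sp.
apply: (IH p1 _ _ sp).
  rewrite monicE -(monicP mp) lead_coefDl ?lead_coefMX //.
  rewrite size_mulX // size_polyC ltnS; case: eqP => //= _.
  by rewrite lt0n size_poly_eq0.
move: Pp; rewrite rmorphD rmorphM /= map_polyX map_polyC hornerD hornerMX hornerC.
set z := _.[y] => Pz; have Qc : Q (iota c).
  apply: (@ideal_addl _ _ (z * y)); first exact: ideal_mul.
  exact: PQ.
have : P (z * y).
  by rewrite -(addrK (iota c) (z * y)); apply: ideal_sub => //; apply: QP.
by case/primeP.
Qed.

End Integrality.

Section Chains.
Variable R : comPzRingType.
Implicit Types (p q : ideal R) (c : nat -> ideal R).

Definition chain_cons p c i := if i is j.+1 then c j else p.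

Lemma prime_chain_cons p c l : prime_ideal p -> p `<` c 0%N ->
  prime_chain c l -> prime_chain (chain_cons p c) l.+1.
Proof. by move=> pp pc [cp cs]; split=> -[|i]; rewrite ?ltnS //=; auto. Qed.

Lemma prime_chain_tail c l : prime_chain c l.+1 -> prime_chain (fun i => c i.+1) l.
Proof. by move=> [cp cs]; split=> i il; [apply: cp | apply: cs]. Qed.

Lemma prime_chain1 p q : prime_ideal p -> prime_ideal q -> p `<` q ->
  prime_chain (chain_cons p (fun=> q)) 1.
Proof. by move=> pp pq ltpq; split=> -[|[|i]]. Qed.

Lemma preim_chain (S : comPzRingType) (h : {rmorphism S -> R}) c l :
  (forall y, exists x, h x = y) ->
  prime_chain c l -> prime_chain (fun i => preim_ideal h (c i)) l.
Proof.
move=> surj [cp cs]; split=> i il; first exact: preim_prime (cp i il).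
have [sub nsub] := cs i il; split=> [x /sub //|sub'].
by apply: nsub => y; have [x <-] := surj y; apply: sub'.
Qed.

End Chains.

Lemma ideal0_prime (R : idomainType) : prime_ideal (ideal0 R).
Proof.
split=> [/eqP|x y /eqP]; first by rewrite oner_eq0.
by rewrite mulf_eq0 => /orP[]/eqP; [left | right].
Qed.

Section FpsDimension.
Variable k : fieldType.
Hypothesis char0 : [pchar k] =i pred0.

(** A chain of primes all containing a nonzero f contracts, in coordinates in
    which f is regular, to a chain of the same length in one variable less. *)
Lemma fps_dim_le n (c : nat -> ideal (fps n k)) l : prime_chain c l -> (l <= n)%N.
Proof.
elim: n c l => [|n IH] c [|l] // [cp cs].
  have [_] := cs 0%N isT; case=> f c1f.
  suff -> : f = 0 by apply: ideal_zero.
  apply: fpsP => m; rewrite [m]nvar0_mnmE fps0E.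
  exact: fps_max_sup (cp 1%N isT).1 c1f.
have [f c1f nf] : exists2 f, c 1%N f & f != 0.
  apply: contrapT => no; have [_] := cs 0%N isT; apply=> f c1f.
  suff -> : f = 0 by apply: ideal_zero.
  by apply: contrapT => /eqP nf; apply: no; exists f.
have [phi [psi [d [a [[phiK psiK reg _] _]]]]] := coordinate_change char0 nf.
pose c' i := preim_ideal psi (c i.+1).
have [c'p c's] : prime_chain c' l.
  apply: preim_chain; last exact: prime_chain_tail (conj cp cs).
  by move=> y; exists (phi y).
have c'f i : (i <= l)%N -> c' i (phi f).
  rewrite /c' /= /preimage /mkset phiK; elim: i => // i IHi il.
  by apply: (cs _ _).1 => //; apply: IHi; apply: ltnW.
rewrite ltnS; apply: (IH (fun i => preim_ideal (@fps_widen n k) (c' i))).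
split=> i il; first by apply: preim_prime; apply: c'p.
have [sub nsub] := c's i il; split=> [a' /sub //|sub'].
apply: nsub; apply: (contraction_strict reg (c'f i (ltnW il))) => //.
by apply: c'p; apply: ltnW.
Qed.

Section Restriction.
Variables n i : nat.

(** The kernels of these ring endomorphisms are the primes (x_0, ..., x_(i-1)),
    without having to compute with generators. *)
Definition fps_zero_first (f : fps n k) : fps n k :=
  Fps (fun m => if [forall j : 'I_n, (j < i)%N ==> (m j == 0%N)] then f m else 0).

Fact fps_zero_first_is_zmod_morphism : zmod_morphism fps_zero_first.
Proof.
by move=> f g; apply: fpsP => m; rewrite fpsBE /=; case: ifP; rewrite ?subr0.
Qed.

Fact fps_zero_first_is_monoid_morphism : monoid_morphism fps_zero_first.
Proof.
split=> [|f g]; apply: fpsP => m.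
  rewrite fps1E /=; case: eqP => [->|]; last by rewrite if_same.
  by case: forallP => // -[] j; rewrite mnm0E implybT.
rewrite fpsME /=; case: ifP => [/forallP m0|/forallP m0].
  apply: eq_bigr => -[u v] /= /eqP e.
  have uv0 (j : 'I_n) : (j < i)%N -> bmnm u j = 0%N /\ bmnm v j = 0%N.
    move=> ji; have /implyP/(_ ji) := m0 j; rewrite (mnm_eq_at j e) mnmDE addn_eq0.
    by move=> /andP[/eqP -> /eqP ->].
  by rewrite !ifT //; apply/forallP => j; apply/implyP => /uv0[u0 v0]; rewrite ?u0 ?v0.
rewrite big1 // => -[u v] /= /eqP e.
case: ifP => [/forallP u0|_]; last by rewrite mul0r.
case: ifP => [/forallP v0|_]; last by rewrite mulr0.
case: m0 => j; apply/implyP => ji.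
by rewrite (mnm_eq_at j e) mnmDE (eqP (implyP (u0 j) ji)) (eqP (implyP (v0 j) ji)).
Qed.

HB.instance Definition _ :=
  GRing.isZmodMorphism.Build (fps n k) (fps n k) fps_zero_first fps_zero_first_is_zmod_morphism.
HB.instance Definition _ :=
  GRing.isMonoidMorphism.Build (fps n k) (fps n k) fps_zero_first fps_zero_first_is_monoid_morphism.

End Restriction.

Lemma fps_krull_dim n : krull_dim (fps n k) n.
Proof.
split; last exact: fps_dim_le.
pose c i := preim_ideal (@fps_zero_first n i) (ideal0 (fps n k)).
exists c; split=> i il; first by apply: preim_prime; apply: ideal0_prime.
split=> [f /= fi|sub].
  apply: fpsP => m /=; case: ifP => [/forallP m0|//].
  have := congr1 (fun g : fps n k => g m) fi; rewrite /= ifT //.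
  apply/forallP => j; apply/implyP => ji; have /implyP := m0 j; apply.
  by rewrite ltnS ltnW.
pose X := fpsX k U_(Ordinal il)%MM.
have /sub : c i.+1 X.
  apply: fpsP => m /=; case: ifP => // /forallP/(_ (Ordinal il)); rewrite /= ltnSn /=.
  by move=> /eqP m0; case: eqP => // mU; rewrite mU mnm1E eqxx in m0.
move/(congr1 (fun g : fps n k => g U_(Ordinal il)%MM)) => /=.
rewrite eqxx ifT => [/eqP|]; first by rewrite oner_eq0.
apply/forallP => j; apply/implyP => ji; by rewrite mnm1E -val_eqE /= (gtn_eqF ji).
Qed.

Lemma fps_max_maximal n : maximal_ideal (fps_max n k).
Proof.
split=> [|I mI nI1]; first exact: fps_max_neq1.
by apply: ideal_setE => f; split=> [/(fps_max_sup nI1)|/mI].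
Qed.

Lemma fps_regular n : regular_local_ring (fps n k).
Proof.
split; first exact: fps_noetherian.
exists (fps_max n k); split; first exact: fps_max_maximal.
  move=> m' [nm1 m'max]; apply/esym; apply: m'max; last exact: fps_max_neq1.
  by move=> f; apply: fps_max_sup.
exists n; split; first exact: fps_krull_dim.
by apply/generated_byE; exists (fun i : 'I_n => fpsX k U_(i)%MM); apply: fps_max_gen.
Qed.

End FpsDimension.

(** * Transport along an isomorphism *)

Section Transport.
Variables (R S : comPzRingType) (h : {rmorphism R -> S}) (g : {rmorphism S -> R}).
Hypotheses (hK : cancel h g) (gK : cancel g h).

Lemma preim_generated_by (I : ideal R) r :
  generated_by I r -> generated_by (preim_ideal g I) r.
Proof.
move=> /generated_byE[a aE]; apply/generated_byE; exists (h \o a) => y.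
split=> [/aE[c yE]|[c ->]].
  exists (h \o c); rewrite -[y]gK yE rmorph_sum.
  by apply: eq_bigr => i _; rewrite rmorphM.
apply: ideal_sum => i _; apply: ideal_mul; rewrite /= /preimage /mkset /= hK.
by apply/aE; apply: span_gen.
Qed.

End Transport.

Lemma regular_transport (R S : comPzRingType) (h : {rmorphism R -> S})
    (g : {rmorphism S -> R}) :
  cancel h g -> cancel g h -> regular_local_ring R -> regular_local_ring S.
Proof.
move=> hK gK [noeth [m [[nm1 mmax] muniq [d [[[c cd] dmax] md]]]]].
have surjh y : exists x, h x = y by exists (g y).
have surjg x : exists y, g y = x by exists (h x).
have preimgK (I : ideal R) x : preim_ideal h (preim_ideal g I) x <-> I x.
  by rewrite /= /preimage /mkset hK.
have preimhK (I : ideal S) x : preim_ideal g (preim_ideal h I) x <-> I x.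
  by rewrite /= /preimage /mkset gK.
split.
  move=> I; have [r Ir] := noeth (preim_ideal h I); exists r.
  have /generated_byE[a aE] := preim_generated_by hK gK Ir.
  by apply/generated_byE; exists a => y; rewrite -aE; apply: iff_sym.
exists (preim_ideal g m); split.
- split=> [|I mI nI1]; first by rewrite /= /preimage /mkset rmorph1.
  have e : preim_ideal h I = m :> set R.
    apply: mmax => [x mx|]; last by rewrite /= /preimage /mkset rmorph1.
    by apply: mI; apply/preimgK.
  apply: ideal_setE => y; apply: iff_trans (iff_sym (preimhK I y)) _.
  exact: (ideal_ext e (g y)).
- move=> m' [nm'1 m'max].
  have e : preim_ideal h m' = m :> set R.
    apply: muniq; split=> [|I m'I nI1]; first by rewrite /= /preimage /mkset rmorph1.
    have e : preim_ideal g I = m' :> set S.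
      apply: m'max => [z m'z|]; last by rewrite /= /preimage /mkset rmorph1.
      by apply: m'I; apply/preimhK.
    apply: ideal_setE => x; apply: iff_trans (iff_sym (preimgK I x)) _.
    exact: (ideal_ext e (h x)).
  apply: ideal_setE => y; apply: iff_trans (iff_sym (preimhK m' y)) _.
  exact: (ideal_ext e (g y)).
exists d; split; last exact: preim_generated_by.
split; first by exists (fun i => preim_ideal g (c i)); apply: preim_chain.
by move=> c' l /(preim_chain surjh)/dmax.
Qed.

Section InverseMorphism.
Variables (R S : comPzRingType) (h : {rmorphism R -> S}).
Hypotheses (h_inj : injective h) (h_surj : forall y, exists x, h x = y).

(** Injectivity is an argument, so that the ring morphism structure can be
    inferred from the term. *)
Definition inverse_morphism of injective h := fun y => projT1 (cid (h_surj y)).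

Let inverse_morphismK : cancel (inverse_morphism h_inj) h.
Proof. by move=> y; rewrite /inverse_morphism; case: (cid _). Qed.

Fact inverse_is_zmod_morphism : zmod_morphism (inverse_morphism h_inj).
Proof. by move=> y z; apply: h_inj; rewrite rmorphB !inverse_morphismK. Qed.

Fact inverse_is_monoid_morphism : monoid_morphism (inverse_morphism h_inj).
Proof.
split=> [|y z]; apply: h_inj; first by rewrite inverse_morphismK rmorph1.
by rewrite rmorphM !inverse_morphismK.
Qed.

HB.instance Definition _ := GRing.isZmodMorphism.Build S R
  (inverse_morphism h_inj) inverse_is_zmod_morphism.
HB.instance Definition _ := GRing.isMonoidMorphism.Build S R
  (inverse_morphism h_inj) inverse_is_monoid_morphism.

Lemma regular_bijection : regular_local_ring R -> regular_local_ring S.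
Proof.
apply: (@regular_transport _ _ h (inverse_morphism h_inj)) => //.
by move=> x; apply: h_inj; rewrite inverse_morphismK.
Qed.

End InverseMorphism.

(** * Prime elements of order one *)

Section OrderOne.
Variables (n : nat) (k : fieldType) (j : 'I_n) (g : fps n k).
Hypothesis lg : lead_at U_(j)%MM g.
Implicit Types (a b y : fps n k).
Local Notation principal := (generated [set g]).

(** Division by g leaves the series that do not involve x_j as remainders; they
    form a domain. *)
Lemma order1_prime : prime_ideal principal.
Proof.
have free_dvd (r : fps n k) : (forall m, (U_(j) <= m)%MM -> r m = 0) -> principal r -> r = 0.
  move=> + /generated1E[c rE]; rewrite rE => r0; have -> : c = 0 by apply: fps_division_uniq lg r0.
  by rewrite mul0r.
split=> [g1|a b gab].
  suff /eqP : (1 : fps n k) = 0 by rewrite oner_eq0.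
  apply: free_dvd g1 => m; rewrite lep1mP fps1E => mj; case: eqP => // m0.
  by rewrite m0 mnm0E in mj.
have [qa [ra [aE ra0]]] := fps_division1 a lg.
have [qb [rb [bE rb0]]] := fps_division1 b lg.
have rem q r y : y = q * g + r -> r = 0 -> principal y.
  by move=> -> ->; apply/generated1E; exists q; rewrite addr0.
have grr : principal (ra * rb).
  have -> : ra * rb = a * b - (qa * b + ra * qb) * g by rewrite aE bE; ring.
  by apply: ideal_sub => //; apply/generated1E; exists (qa * b + ra * qb).
have /eqP : ra * rb = 0.
  apply: free_dvd grr => m; rewrite lep1mP fpsME => mj; apply: big1 => -[u v] /= /eqP e.
  move: mj; rewrite (mnm_eq_at j e) mnmDE addn_eq0 negb_and -!lep1mP.
  by move=> /orP[/ra0->|/rb0->]; rewrite ?mul0r ?mulr0.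
rewrite mulf_eq0 => /orP[]/eqP r0.
- by left; apply: rem aE r0.
- by right; apply: rem bE r0.
Qed.

Lemma order1_order_ge : order_ge 1 g.
Proof. by have := lead_order_ge lg; rewrite mdeg1. Qed.

(** A prime properly contained in (g) lies in every power of (g), so it is zero. *)
Lemma order1_height (p : ideal (fps n k)) : p = principal :> set _ -> has_height p 1.
Proof.
move=> pE; have gg : p g by apply/(ideal_ext pE); apply: generated_in.
have pprime : prime_ideal p.
  have [n1 pM] := order1_prime; split=> [/(ideal_ext pE)//|x y /(ideal_ext pE)/pM].
  by case=> /(ideal_ext pE); [left | right].
split.
  exists (chain_cons (ideal0 _) (fun=> p)); split=> //.
  apply: prime_chain1 => //; first exact: ideal0_prime.
  split=> [_ ->|/(_ g gg)/eqP]; first exact: ideal_zero.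
  by rewrite (negPf (lead_at_neq0 lg)).
move=> c [|[|l]] // [cp cs] clE.
have [_ []] := cs l (ltnW (ltnSn _)); have [qp npq] := cs l.+1 (ltnSn _).
rewrite clE in qp npq; have [q1 qM] := cp l.+1 (leqnSn _).
have nqg : ~ c l.+1 g.
  by move=> qg; apply: npq => y /(ideal_ext pE)/generated1E[b ->]; apply: ideal_mul.
have powers N y : c l.+1 y -> exists z, y = z * g ^+ N /\ c l.+1 z.
  elim: N y => [|N IH] y qy; first by exists y; rewrite mulr1.
  have /(ideal_ext pE)/generated1E[z yE] := qp _ qy.
  have [|z' [zE qz']] := IH z; first by move: qy; rewrite yE => /qM[].
  by exists z'; rewrite yE zE exprSr mulrA.
move=> y qy; suff -> : y = 0 by apply: ideal_zero.
apply: fpsP => m; have [z [-> _]] := powers (mdeg m).+1 y qy.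
apply: (order_geMl (d := (mdeg m).+1)) => //.
by have := order_geXn (e := (mdeg m).+1) order1_order_ge; rewrite mul1n.
Qed.

End OrderOne.

Lemma lead_at_order1 n (k : fieldType) (f : fps n k) i : order_ge 1 f ->
  f U_(i)%MM != 0 -> exists j, lead_at U_(j)%MM f.
Proof.
move=> f1 fi; have [|m lf] := @lead_at_exists n k f; first by apply: contraNneq fi => ->.
suff /mdeg1P[j /eqP mE] : mdeg m == 1%N by exists j; rewrite -mE.
rewrite eqn_leq (order_ge_lead f1 lf) andbT leqNgt; apply: contraNN fi => lt.
by rewrite (lead_at_mdeg lf) // mdeg1.
Qed.

(** * Derivations *)

Section Derivations.
Variables (n : nat) (k : fieldType).
Implicit Types (f g u : fps n k).

Lemma fps_derivM i f g : fps_deriv i (f * g) = fps_deriv i f * g + f * fps_deriv i g.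
Proof.
apply: fpsP => m; have [Af Ag] := (@agree_truncate _ _ (mdeg m).+2 f, @agree_truncate _ _ (mdeg m).+2 g).
have [Bf Bg] := (agree_sub (leqnSn _) Af, agree_sub (leqnSn _) Ag).
have [Df Dg] := (agree_deriv i Af, agree_deriv i Ag).
rewrite (agree_deriv i (agreeM Af Ag)) // mderivM.
by rewrite (agreeD (agreeM Df Bg) (agreeM Bf Dg)).
Qed.

Lemma fps_derivXn i f a : fps_deriv i (f ^+ a.+1) = a.+1%:R * f ^+ a * fps_deriv i f.
Proof.
elim: a => [|a IH]; first by rewrite expr1 expr0 !mul1r.
rewrite exprS fps_derivM IH -[in RHS]natr1 !exprS.
by move: (a.+1%:R) (f ^+ a) (fps_deriv i f) => c F D; ring.
Qed.

Lemma fps_deriv0 i f : (fps_deriv i f) 0%MM = f U_(i)%MM.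
Proof. by rewrite /= mnm0E add0m mulr1n. Qed.

Lemma order_ge_deriv d i f : order_ge d f -> order_ge d.-1 (fps_deriv i f).
Proof.
by move=> df m lt /=; rewrite df ?mul0rn // mdegD mdeg1; lia.
Qed.

Definition order_ideal d : ideal (fps n k) :=
  @Ideal (fps n k) (order_ge d) (fun _ _ => erefl)
    (@order_geD n k d) (@order_geMl n k d).

Lemma jacobian_order d f : order_ge d f -> jacobian_ideal f `<=` order_ge d.-1.
Proof.
move=> df; apply: (generated_sub (I := order_ideal d.-1)) => y [->|].
  by move=> m lt; apply: df; apply: leq_trans lt (leq_pred _).
apply: (generated_sub (I := order_ideal d.-1)) => _ [i _ <-].
exact: order_ge_deriv.
Qed.

Lemma jacobian_self f : jacobian_ideal f f.
Proof. by apply: generated_in; left. Qed.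

Lemma jacobian_deriv f i : jacobian_ideal f (fps_deriv i f).
Proof. by apply: generated_in; right; apply: generated_in; exists i. Qed.

Lemma jacobian_sub f (I : ideal (fps n k)) :
  I f -> (forall i, I (fps_deriv i f)) -> jacobian_ideal f `<=` I.
Proof.
by move=> If Id; apply: generated_sub => y [->//|]; apply: generated_sub => _ [i _ <-].
Qed.

End Derivations.

(** * Associated primes and quotients *)

Section Quotients.
Variables (R : comPzRingType) (I : ideal R).

Definition quo_proj (x : R) : quo I := \pi_(quo I)%qT x.

Fact quo_proj_is_zmod_morphism : zmod_morphism quo_proj.
Proof. by move=> x y; rewrite /quo_proj raddfB. Qed.

Fact quo_proj_is_monoid_morphism : monoid_morphism quo_proj.
Proof. by split=> // x y; apply: quo_pi_mul. Qed.

HB.instance Definition _ :=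
  GRing.isZmodMorphism.Build R (quo I) quo_proj quo_proj_is_zmod_morphism.
HB.instance Definition _ :=
  GRing.isMonoidMorphism.Build R (quo I) quo_proj quo_proj_is_monoid_morphism.

Lemma quo_proj_eq x y : quo_proj x = quo_proj y <-> I (x - y).
Proof. exact: quo_eqP. Qed.

Lemma quo_proj_surj z : exists x, quo_proj x = z.
Proof. by have [x ->] := quo_surj z; exists x. Qed.

Lemma quo_proj0 x : quo_proj x = 0 <-> I x.
Proof. by rewrite -(rmorph0 quo_proj) quo_proj_eq subr0. Qed.

(** The annihilator of the cyclic module generated by the class of s is (I : s). *)
Lemma Ass_quoE (p : ideal R) :
  Ass (quo I) p <-> prime_ideal p /\ exists s, forall y, p y <-> I (y * s).
Proof.
have annE z s y : z = quo_proj s -> annihilator (cyclic_submodule z) y <-> I (y * s).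
  move=> zE; have scaleE (a : R) (w : quo I) : a *: w = quo_proj a * w by [].
  split=> [/(_ _ (ex_intro2 _ _ 1 Logic.I erefl))|Iys _ [a _ <-]].
    by rewrite !scaleE rmorph1 mul1r zE -rmorphM => /quo_proj0.
  rewrite !scaleE zE -(rmorphM quo_proj a s) -(rmorphM quo_proj y); apply/quo_proj0.
  by rewrite mulrCA; apply: ideal_mul.
split=> -[pp [z pE]]; split=> //.
  have [s sE] := quo_proj_surj z; exists s => y.
  by rewrite pE; apply: annE (esym sE).
exists (quo_proj z); apply/funext => y; apply/propext.
by rewrite pE; apply: iff_sym; apply: annE erefl.
Qed.

End Quotients.

Lemma fps_natr_neq0 n (k : fieldType) d : [pchar k] =i pred0 ->
  d.+1%:R != 0 :> k /\ ((d.+1%:R : fps n k) 0%MM = d.+1%:R).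
Proof.
move=> /pcharf0P char0; split; first by rewrite char0.
by rewrite fpsMnE fps1E eqxx.
Qed.

Local Notation rad f := (radical (generated [set f])).

(** * Powers of an element of order one *)

Section PrimePowers.
Variables (n : nat) (k : fieldType) (j : 'I_n) (g : fps n k).
Hypothesis char0 : [pchar k] =i pred0.
Hypothesis lg : lead_at U_(j)%MM g.
Implicit Types (f u c s y : fps n k).

Let g_neq0 : g != 0. Proof. exact: lead_at_neq0 lg. Qed.

Let prime_g y s : (exists c, y * s = c * g) -> (exists c, y = c * g) \/ exists c, s = c * g.
Proof.
move=> /generated1E; have [_ pM] := order1_prime lg.
by case/pM => /generated1E; [left | right].
Qed.

Lemma factor_of_power a f c : f * c = g ^+ a ->
  exists u b, u \is a GRing.unit /\ f = u * g ^+ b.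
Proof.
elim: a f c => [|a IH] f c fc.
  exists f, 0%N; rewrite expr0 mulr1; split=> //.
  by apply/unitrPr; exists c.
have [|[f' fE]|[c' cE]] := @prime_g f c; first by exists (g ^+ a); rewrite fc exprSr.
  have [u [b [uU f'E]]] : exists u b, u \is a GRing.unit /\ f' = u * g ^+ b.
    apply: (IH _ c); apply: (mulIf g_neq0); rewrite -exprSr -fc fE; ring.
  by exists u, b.+1; rewrite exprSr mulrA -f'E.
apply: (IH _ c'); apply: (mulIf g_neq0); rewrite -exprSr -fc cE; ring.
Qed.

Lemma power_dvd_mul b y s : (exists c, y * s = c * g ^+ b) ->
  (exists c, y = c * g) \/ exists c, s = c * g ^+ b.
Proof.
move=> [c ysE]; have [|ngy] := pselect (exists c, y = c * g); first by left.
right; elim: b c ysE => [|b IH] c ysE; first by exists s; rewrite mulr1.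
have [|s' sE] := IH (c * g); first by rewrite ysE exprS mulrA.
have [|//|[c' s'E]] := @prime_g y s'; last by exists c'; rewrite sE s'E exprS mulrA.
exists c; apply: (mulIf (expf_neq0 b g_neq0)).
by rewrite -mulrA -sE ysE exprS mulrA.
Qed.

(** Every partial derivative of u g^(b+1) is divisible by g^b, and for the one
    along x_j the cofactor is invertible, as b+1 is. *)
Lemma jacobian_power f u b : u \is a GRing.unit -> f = u * g ^+ b.+1 ->
  forall y, jacobian_ideal f y <-> exists c, y = c * g ^+ b.
Proof.
move=> uU fE y; rewrite -generated1E.
have derivE i : fps_deriv i f =
    (fps_deriv i u * g + u * (b.+1%:R * fps_deriv i g)) * g ^+ b.
  rewrite fE fps_derivM fps_derivXn exprS.
  by move: (b.+1%:R) (g ^+ b) (fps_deriv i u) (fps_deriv i g) => c G D D'; ring.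
split.
  apply: jacobian_sub => [|i]; apply/generated1E; last by rewrite derivE; eexists.
  by exists (u * g); rewrite fE exprS mulrA.
apply: generated_sub => _ ->.
have /divrr DV : fps_deriv j u * g + u * (b.+1%:R * fps_deriv j g) \is a GRing.unit.
  have [b0 bE] := @fps_natr_neq0 n k b char0.
  rewrite fps_unitE fpsDE !fps_const0M bE (order1_order_ge lg) ?mdeg0 // mulr0 add0r.
  by rewrite fps_deriv0 !mulf_neq0 ?b0 ?lg.1 // -fps_unitE.
rewrite -[g ^+ b]mul1r -DV mulrAC -derivE; apply: ideal_mulr; exact: jacobian_deriv.
Qed.

(** A prime of the form (g^b : s) contains g, and each of its elements y is
    divisible by g, since otherwise g^b would divide s. *)
Lemma Ass_jacobian_power f u b p : u \is a GRing.unit -> f = u * g ^+ b.+1 ->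
  Ass (quo (jacobian_ideal f)) p -> has_height p 1.
Proof.
move=> uU fE /Ass_quoE[pp [s ps]]; apply: (order1_height lg).
have {}ps y : p y <-> exists c, y * s = c * g ^+ b.
  by rewrite ps; apply: jacobian_power uU fE _.
have pg : p g by apply: (prime_expr (m := b) pp); apply/ps; exists s; rewrite mulrC.
apply: ideal_setE => y; rewrite generated1E; split=> [/ps|[c ->]]; last exact: ideal_mul.
case/power_dvd_mul => // -[c sE]; case: (pp.1); apply/ps.
by exists c; rewrite mul1r.
Qed.

End PrimePowers.

(** * A regular quotient forces a power of an element of order one *)

Section RegularQuotient.
Variables (n : nat) (k : fieldType) (f : fps n k).
Hypothesis char0 : [pchar k] =i pred0.
Hypotheses (f_neq0 : f != 0) (f_nonunit : f \isn't a GRing.unit).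
Local Notation S := (quo (rad f)).
Local Notation proj := (quo_proj (rad f)).

Let rad_max y : rad f y -> fps_max n k y.
Proof.
apply: fps_max_sup; case=> a; rewrite expr1n => /generated1E[c c1].
by case/negP: f_nonunit; apply/unitrPr; exists c; rewrite mulrC.
Qed.

(** A chain of primes of the quotient lifts to primes containing f; the zero
    ideal can be put in front of it. *)
Lemma quo_dim_lt d : krull_dim S d -> (d < n)%N.
Proof.
move=> [[c cd] _].
have := prime_chain_cons (ideal0_prime _) _ (preim_chain (@quo_proj_surj _ (rad f)) cd).
move=> H; apply: (fps_dim_le char0 (H _)); split=> [_ ->|sub]; first exact: ideal_zero.
have rf : rad f f by exists 1%N; rewrite expr1; apply: generated_in.
have /sub/eqP : preim_ideal proj (c 0%N) f.
  by rewrite /= /preimage /mkset ((quo_proj0 _ _).2 rf); apply: ideal_zero.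
by rewrite (negPf f_neq0).
Qed.

Lemma coef_linear_mul (r s : fps n k) i : s 0%MM = 0 ->
  (r * s) U_(i)%MM = r 0%MM * s U_(i)%MM.
Proof.
move=> s0; rewrite -!fps_deriv0 fps_derivM fpsDE !fps_const0M s0 mulr0 add0r.
by [].
Qed.

(** The maximal ideal of S has d < n generators. If all elements of the radical
    had zero linear part, the n variables would have their linear parts spanned
    by those of d series, against the rank of the identity matrix. *)
Lemma regular_quo_order1 : regular_local_ring S ->
  exists j g, lead_at U_(j)%MM g /\ rad f g.
Proof.
move=> [_ [m [[nm1 mmax] _ [d [dimd /generated_byE[a aE]]]]]].
have lt_dn := quo_dim_lt dimd.
have max_m y : fps_max n k y -> m (proj y).
  move=> y0; have [I IE] : exists I : ideal S, forall z, I z <->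
      exists2 x, fps_max n k x & proj x = z.
    have I0 : exists2 x, fps_max n k x & proj x = 0.
      by exists 0; [apply: ideal_zero | apply: rmorph0].
    have ID z z' : (exists2 x, fps_max n k x & proj x = z) ->
        (exists2 x, fps_max n k x & proj x = z') ->
        exists2 x, fps_max n k x & proj x = z + z'.
      move=> [x x0 <-] [x' x'0 <-]; exists (x + x'); first exact: ideal_add.
      by rewrite rmorphD.
    have IM b z : (exists2 x, fps_max n k x & proj x = z) ->
        exists2 x, fps_max n k x & proj x = b * z.
      move=> [x x0 <-]; have [b' <-] := quo_proj_surj b.
      by exists (b' * x); [apply: ideal_mul | rewrite rmorphM].
    by exists (Ideal I0 ID IM).
  have : I = m :> set S.
    apply: mmax => [z mz|/IE[x x0 x1]].
      have [x xz] := quo_proj_surj z; apply/IE; exists x => //.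
      apply: (@fps_max_sup _ _ (preim_ideal proj m)); last by rewrite -xz in mz.
      by rewrite /= /preimage /mkset rmorph1.
    have : rad f (x - 1) by apply/quo_proj_eq; rewrite rmorph1.
    move=> /rad_max/(ideal_sub x0); rewrite opprB addrC subrK; exact: fps_max_neq1.
  by move/ideal_ext <-; apply/IE; exists y.
have /choice[b bE] : forall i, exists x, proj x = a i by move=> i; apply: quo_proj_surj.
have b0 i : b i 0%MM = 0.
  apply: (@fps_max_sup _ _ (preim_ideal proj m)).
    by rewrite /= /preimage /mkset rmorph1.
  suff : m (proj (b i)) by []; rewrite bE; apply/aE; exact: span_gen.
have /choice[r rE] : forall j : 'I_n, exists r : 'I_d -> fps n k,
    rad f (fpsX k U_(j)%MM - \sum_i r i * b i).
  move=> j; have /aE[c cE] : m (proj (fpsX k U_(j)%MM)).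
    by apply: max_m; rewrite /= eq_sym mnm1_eq0.
  have /choice[c' c'E] : forall i, exists x, proj x = c i by move=> i; apply: quo_proj_surj.
  exists c'; apply/quo_proj_eq; rewrite cE rmorph_sum; apply: eq_bigr => i _.
  by rewrite rmorphM /= bE c'E.
apply: contrapT => no.
pose N : 'M[k]_(n, d) := \matrix_(j, i) r j i 0%MM.
pose B : 'M[k]_(d, n) := \matrix_(i, l) b i U_(l)%MM.
suff NB1 : N *m B = 1%:M.
  by have := mxrankM_maxl N B; rewrite NB1 mxrank1 => /leq_trans/(_ (rank_leq_col N)); rewrite leqNgt lt_dn.
apply/matrixP => j l; rewrite !mxE.
set s := fpsX k U_(j)%MM - \sum_i r j i * b i.
have sl : s U_(l)%MM = 0.
  apply: contrapT => /eqP nz; apply: no.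
  have s1 : order_ge 1 s by apply/order_ge1; apply: rad_max; apply: rE.
  have [j' lj'] := lead_at_order1 s1 nz; exists j', s; split=> //; exact: rE.
move/eqP: sl; rewrite fpsBE fps_sumE subr_eq0 => /eqP e.
transitivity (fpsX k U_(j)%MM U_(l)%MM).
  rewrite e; apply: eq_bigr => i _; rewrite !mxE.
  by rewrite coef_linear_mul.
by rewrite /= eq_mnm1 eq_sym.
Qed.

(** Since g is prime and f divides a power of g, f is itself a power of g up to a
    unit. *)
Lemma regular_quo_power : regular_local_ring S ->
  exists j g u b, [/\ lead_at U_(j)%MM g, u \is a GRing.unit & f = u * g ^+ b.+1].
Proof.
move=> /regular_quo_order1[j [g [lg [a /generated1E[c ga]]]]].
have [|u [b [uU fE]]] := factor_of_power lg (a := a) (f := f) (c := c).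
  by rewrite mulrC.
case: b fE => [|b] fE; last by exists j, g, u, b.
by move: f_nonunit; rewrite fE expr0 mulr1 uU.
Qed.

End RegularQuotient.

(** * Unmixed Jacobian ideals *)

Section LastVariable.
Variables (n : nat) (k : fieldType).
Hypothesis char0 : [pchar k] =i pred0.
Local Notation A := (fps n k).
Local Notation R := (fps n.+1 k).
Local Notation iota := (@fps_widen n k).
Implicit Types (f g F G H : R) (J : ideal R).

Lemma lead_regular1 g : regular_at 1 g -> lead_at U_(ord_max)%MM g.
Proof. by rewrite /regular_at mulm1n. Qed.

(** R/(w) is free over A, so that multiplication by a nonzero element of A is
    injective on it. *)
Lemma regular_cancel d w (a : A) f : regular_at d w -> a != 0 ->
  (exists c, iota a * f = c * w) -> exists c, f = c * w.
Proof.
move=> regw na [c0 fw]; have [q [c fE]] := weierstrass_division f regw.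
exists q; rewrite fE; suff c_eq0 i : (i < d)%N -> c i = 0.
  by rewrite (eq_low c_eq0) low0 addr0.
have : (c0 - iota a * q) * w = low d (fun i => a * c i).
  by rewrite -lowM mulrBl -fw fE mulrDr mulrA addrC addKr.
case/(weierstrass_uniq regw) => _ ac id; apply/eqP.
by have /eqP := ac i id; rewrite mulf_eq0 (negPf na).
Qed.

(** A prime that contains both a w regular in x_last and a nonzero element of A
    is not minimal over (w): it contains properly a prime that avoids that
    element. Hence if the associated primes of R/J have height one, none of
    them meets A. *)
Lemma torsionfree_of_height1 J D H : J H -> regular_at D H ->
  (forall p s, prime_ideal p -> (forall y, p y <-> J (y * s)) ->
     forall q, prime_ideal q -> q `<=` p -> (exists2 y, q y & y != 0) -> p `<=` q) ->
  forall (a : A) f, a != 0 -> J (iota a * f) -> J f.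
Proof.
move=> JH regH height1 a f na Jaf; apply: contrapT => nJf.
have [p [s [pp ps pcolon]]] := prime_colon (@fps_noetherian n.+1 k) nJf.
have pa : p (iota a) by apply: pcolon.
have pH : p H by apply/ps; apply: ideal_mulr.
pose T := [set z : R | exists i t, ~ p t /\ z = iota a ^+ i * t].
have [q [pq Hq qT]] : exists q : ideal R, [/\ prime_ideal q,
    generated [set H] `<=` q & forall x, q x -> ~ T x].
  apply: prime_avoiding; first exact: fps_noetherian.
  - by exists 0%N, 1; split; [exact: pp.1 | rewrite mulr1].
  - move=> _ _ [i [t [nt ->]]] [i' [t' [nt' ->]]]; exists (i + i')%N, (t * t').
    by split; [move=> /pp.2[] | rewrite exprD mulrACA].
  move=> x /generated1E[c xE] [i [t [nt xE']]]; apply: nt.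
  have [|b ->] := @regular_cancel D H (a ^+ i) t regH (expf_neq0 i na).
    by exists c; rewrite rmorphXn -xE'.
  exact: ideal_mul.
have qp : q `<=` p.
  move=> t qt; apply: contrapT => npt; apply: (qT t) => //.
  by exists 0%N, t; rewrite mul1r.
have /(_ _ pa) : p `<=` q.
  apply: (height1 p s) => //; exists H; last exact: lead_at_neq0 regH.
  by apply: Hq; apply: generated_in.
move/qT; apply; exists 1%N, 1; split; [exact: pp.1 | by rewrite expr1 mulr1].
Qed.

Lemma regular_deriv d F : regular_at d.+1 F -> regular_at d (fps_deriv ord_max F).
Proof.
move=> [nz lo]; have e : (U_(ord_max) *+ d + U_(ord_max) = U_(ord_max : 'I_n.+1) *+ d.+1)%MM.
  by rewrite mulmSr.
split=> [|m lt] /=; last first.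
  rewrite lo ?mul0rn // -e; by rewrite ltmc_add2l.
by rewrite e -mulr_natr mulf_neq0 // ((pcharf0P k).1 char0).
Qed.

(** The leading coefficients in F = g F' show that g has order one and that its
    coefficient at x_last is 1/(d+1). Write F = w g^a with w not divisible by g.
    Then F = g F' becomes w (1 - a g') = g w', so that g divides 1 - a g', whose
    constant term must vanish: a = d+1, and w has order zero. *)
Lemma divisible_by_deriv d F g : regular_at d.+1 F ->
  F = g * fps_deriv ord_max F ->
  regular_at 1 g /\ exists w, w \is a GRing.unit /\ F = w * g ^+ d.+1.
Proof.
move=> regF FE; have regH := regular_deriv regF; set H := fps_deriv _ F in FE regH.
have ng : g != 0.
  by apply: contraTneq (lead_at_neq0 regF) => g0; rewrite FE g0 mul0r eqxx.
have reg1 : regular_at 1 g.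
  have [nu lg] := lead_at_exists ng; have := lead_atM lg regH.
  rewrite -FE => /(lead_at_inj regF); rewrite mulmS => /addIm nuE.
  by rewrite /regular_at mulm1n nuE.
split=> //; have lg := lead_regular1 reg1.
have g1 : g U_(ord_max)%MM * d.+1%:R = 1.
  have := lead_at_coefM reg1 regH; rewrite -FE addmC -mulmSr mulm1n /= -mulmSr.
  move=> e; apply: (mulIf regF.1); rewrite mul1r [RHS]e -mulrA mulr_natl; congr (_ * _).
  by rewrite mulmnE mnm1E eqxx mul1n.
pose pow a := `[< exists w, F = w * g ^+ a >].
have pow_le a : pow a -> (a <= d.+1)%N.
  move=> /asboolP[w FwE]; have nw : w != 0.
    by apply: contraTneq (lead_at_neq0 regF) => w0; rewrite FwE w0 mul0r eqxx.
  have [nu lw] := lead_at_exists nw; have := lead_atM lw (lead_atXn a lg).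
  rewrite -FwE => /(lead_at_inj regF) /mnmP/(_ ord_max).
  by rewrite mnmDE !mulmnE mnm1E eqxx !mul1n => ->; apply: leq_addl.
have pow1 : pow 1%N by apply/asboolP; exists H; rewrite expr1 mulrC.
have [[|a] /asboolP[w FwE] amax] := ex_maxnP (ex_intro _ 1%N pow1) pow_le.
  by have := amax 1%N pow1.
have ngw c : w <> c * g.
  move=> wE; have := amax a.+2; rewrite ltnn => Hm; suff /Hm : pow a.+2 by [].
  by apply/asboolP; exists c; rewrite FwE wE [in RHS]exprS mulrA.
have wE : w * (1 - a.+1%:R * fps_deriv ord_max g) = fps_deriv ord_max w * g.
  apply: (mulIf (expf_neq0 a.+1 ng)); have := FE.
  rewrite /H {1}FwE FwE fps_derivM fps_derivXn exprS => FE'.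
  rewrite mulrBr mulr1 mulrBl FE'.
  by move: (a.+1%:R) (g ^+ a) (fps_deriv _ w) (fps_deriv _ g) => c G D D'; ring.
have a1 : a.+1%:R * g U_(ord_max)%MM = 1 :> k.
  have : generated [set g] (w * (1 - a.+1%:R * fps_deriv ord_max g)).
    by apply/generated1E; exists (fps_deriv ord_max w).
  case/(order1_prime lg).2 => /generated1E[c]; first by move/ngw.
  move/(congr1 (fun z : R => z 0%MM)); rewrite fpsBE !fps_const0M fps_deriv0.
  rewrite (fps_natr_neq0 n.+1 a char0).2 (order1_order_ge lg (m := 0%MM)) ?mdeg0 // mulr0 fps1E eqxx.
  by move/eqP; rewrite subr_eq0 => /eqP <-.
have ad : a = d.
  have gn : g U_(ord_max)%MM != 0 by case: lg.
  apply: succn_inj; apply: (natr_inj char0); apply: (mulIf gn).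
  by rewrite a1 mulrC g1.
exists w; rewrite FwE ad; split=> //; rewrite fps_unitE.
have nw : w != 0.
  by apply: contraTneq (lead_at_neq0 regF) => w0; rewrite FwE w0 mul0r eqxx.
have [nu lw] := lead_at_exists nw; have := lead_atM lw (lead_atXn a.+1 lg).
rewrite -FwE ad => /(lead_at_inj regF); rewrite -{1}[(U_(ord_max) *+ _)%MM]add0m.
by move=> /addIm ->; case: lw.
Qed.

(** J is torsion-free over A and its elements have order at least that of the
    derivative H of F, so that H generates J; in particular H divides F. *)
Lemma unmixed_regular J d F : regular_at d.+1 F -> J F -> J (fps_deriv ord_max F) ->
  J `<=` order_ge d ->
  (forall p s, prime_ideal p -> (forall y, p y <-> J (y * s)) ->
     forall q, prime_ideal q -> q `<=` p -> (exists2 y, q y & y != 0) -> p `<=` q) ->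
  exists g w, [/\ regular_at 1 g, w \is a GRing.unit & F = w * g ^+ d.+1].
Proof.
move=> regF JF JH Jord height1; have regH := regular_deriv regF.
have tf := torsionfree_of_height1 JH regH height1.
have [g FE] := torsionfree_principal JH regH Jord tf JF.
have [reg1 [w [wU wE]]] := divisible_by_deriv regF FE.
by exists g, w.
Qed.

(** In the new coordinates the radical is the prime (g), and division by g, which
    is regular of order one, identifies the quotient with A. *)
Lemma quo_rad_regular f (phi psi : {rmorphism R -> R}) d g w :
  cancel phi psi -> cancel psi phi -> regular_at 1 g -> w \is a GRing.unit ->
  phi f = w * g ^+ d.+1 -> regular_local_ring (quo (rad f)).
Proof.
move=> phiK psiK reg1 wU FE; have lg := lead_regular1 reg1.
pose h : {rmorphism A -> quo (rad f)} := quo_proj (rad f) \o (psi \o iota).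
apply: (@regular_bijection _ _ h); last exact: fps_regular.
  move=> a b /eqP; rewrite -subr_eq0 -rmorphB => /eqP/quo_proj0[N /generated1E[c abE]].
  apply/eqP; rewrite -subr_eq0; apply/eqP; set z := a - b in abE *.
  have : generated [set g] (iota z ^+ N).
    apply/generated1E; exists (phi c * w * g ^+ d).
    have abE' : psi (iota z) ^+ N = c * f := abE.
    by rewrite -[iota z]psiK -rmorphXn abE' rmorphM FE exprSr !mulrA.
  move/(prime_expr (order1_prime lg))/generated1E => [q].
  by rewrite -low1 => /esym/(weierstrass_uniq reg1)[_ /(_ 0%N isT)].
move=> y; have [x <-] := quo_proj_surj y.
have [q [c xE]] := weierstrass_division (phi x) reg1.
exists (c 0%N); apply/quo_proj_eq; rewrite /=.
have -> : psi (iota (c 0%N)) - x = psi (- q * g).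
  rewrite -[x in LHS]phiK -rmorphB xE -low1; congr (psi _).
  rewrite (eq_low (c' := fun=> c 0%N)) => [|[]//]; by rewrite opprD addrCA subrr addr0 mulNr.
exists d.+1; rewrite -rmorphXn exprMn; apply/generated1E.
exists (psi ((- q) ^+ d.+1 * w^-1)); rewrite -[f in RHS]phiK -rmorphM FE.
by rewrite -mulrA mulKr.
Qed.

End LastVariable.

(** * The regularity criterion *)

Theorem theorem3p3 (k : fieldType) (n : nat) (f : fps n k) :
  [pchar k] =i pred0 ->
  f != 0 ->
  f \isn't a GRing.unit ->
  regular_local_ring (quo (radical (generated [set f]))) <->
  (forall p : ideal (fps n k),
     Ass (quo (jacobian_ideal f)) p -> has_height p 1).
Proof.
move=> char0 nf f_nonunit; split.
  move=> /(regular_quo_power char0 nf f_nonunit)[j [g [u [b [lg uU fE]]]]] p.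
  exact: (Ass_jacobian_power char0 lg uU fE).
case: n f nf f_nonunit => [|n] f nf f_nonunit height1.
  case/negP: f_nonunit; rewrite fps_unitE; apply: contraNneq nf => f0.
  by apply/eqP; apply: fpsP => m; rewrite [m]nvar0_mnmE f0.
have [phi [psi [d [a [[phiK psiK regF df] [phi_order chain]]]]]] := coordinate_change char0 nf.
case: d => [|d] in regF df.
  case/negP: f_nonunit; suff /rmorph_unit : phi f \is a GRing.unit by move/(_ _ psi); rewrite phiK.
  by rewrite fps_unitE; move: regF => []; rewrite mulm0n.
have JE y : preim_ideal psi (jacobian_ideal f) y <-> jacobian_ideal f (psi y) by [].
have [||||g [w [reg1 wU FE]]] := unmixed_regular char0 (J := preim_ideal psi (jacobian_ideal f)) regF.
- by apply/JE; rewrite phiK; apply: jacobian_self.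
- apply/JE; rewrite chain rmorph_sum; apply: ideal_sum => i _.
  by rewrite rmorphM phiK; apply: ideal_mul; apply: jacobian_deriv.
- by move=> y /JE /(jacobian_order df)/phi_order; rewrite psiK.
- move=> p s pp ps q qp sub [y qy ny].
  have Ap : Ass (quo (jacobian_ideal f)) (preim_ideal phi p).
    apply/Ass_quoE; split; first exact: preim_prime.
    exists (psi s) => z; rewrite /= /preimage /mkset ps JE.
    by rewrite rmorphM phiK.
  have [_ /(_ (chain_cons (ideal0 _) (chain_cons (preim_ideal phi q) (fun=> preim_ideal phi p))) 2%N)] :=
    height1 _ Ap.
  move=> no z pz; apply: contrapT => nqz.
  suff : (2 <= 1)%N by [].
  apply: no => //; apply: prime_chain_cons; first exact: ideal0_prime.
    split=> [_ ->|/(_ (psi y))]; first exact: ideal_zero.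
    rewrite /= /preimage /mkset psiK => /(_ qy)/(congr1 phi); rewrite psiK rmorph0.
    by apply/eqP.
  apply: prime_chain1; [exact: preim_prime | exact: preim_prime |].
  split=> [t /sub //|/(_ (psi z))]; rewrite /= /preimage /mkset psiK.
  by move=> /(_ pz)/nqz.
exact: quo_rad_regular phiK psiK reg1 wU FE.
Qed.
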